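(* Let $p\in(0,1)$ and let $X_n$ be the number of correct guesses under the optimal strategy in the complete feedback game after one asymmetric single-shelf shuffle of $n$ cards with parameter $p$. Put $\mu_n=\mathbb{E}(X_n)$, $\sigma_n=\sqrt{\mathrm{Var}(X_n)}$ and $p_{n,k}=\mathbb{P}(X_n=k)$. Then $X_n$ satisfies a local limit law of the Gaussian type with rate $\varepsilon_n=O_p(n^{-1/2})$; that is, there is a sequence $\varepsilon_n$ and a constant $C_p>0$ depending only on $p$ with $\varepsilon_n\le C_p n^{-1/2}$ for all large $n$ such that \[ \sup_{x\in\mathbb{R}}\left|\sigma_n\,p_{n,\lfloor \mu_n+x\sigma_n\rfloor}-\frac{1}{\sqrt{2\pi}}e^{-x^2/2}\right|\le \varepsilon_n . \]
   Context: Asymmetric single-shelf shuffle with parameter $p\in(0,1)$: start with an ordered deck of $n$ cards labelled $1,\dots,n$ (card $1$ on top). Cards are drawn one at a time from the bottom of the deck (card $n$ first, card $1$ last) and placed in a pile; independently, each drawn card is placed at the top of the pile with probability $p$ and at the bottom with probability $1-p$. Equivalently, let $\varepsilon_1,\dots,\varepsilon_{n-1}$ be independent Bernoulli$(p)$ ($\varepsilon_j=1$ iff card $j$ is placed at the top); the shuffled deck read from the top consists of the cards $j\le n-1$ with $\varepsilon_j=1$ in increasing order, then card $n$, then the cards with $\varepsilon_j=0$ in decreasing order. (These Bernoulli variables are unrelated to the rate sequence $\varepsilon_n$ of the claim.) Complete feedback game: the player guesses the cards of the shuffled deck sequentially from the top; after each guess the card is shown and removed. Let $\nu=1$ if $p\ge\frac12$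 and $\nu=\lfloor \log p/\log(1-p)\rfloor+1$ if $0<p<\frac12$. Optimal strategy used: let $j$ be the label of the last card shown ($j=0$ before the first guess). As long as neither card $n$ nor card $n-1$ has been shown: if $p\ge\frac12$, guess $j+1$; if $p<\frac12$, guess $n$ when $n-j\le\nu$ and guess $j+1$ when $n-j>\nu$. Once card $n$ or $n-1$ has been shown, guess the remaining cards in decreasing order. $X_n=X_n(p)$ denotes the number of correct guesses under this strategy. *)

(* Defs.v *)
From HB Require Import structures.
From mathcomp Require Import all_boot all_order all_algebra.
From mathcomp Require Import all_classical all_reals all_analysis.

Set Implicit Arguments.
Unset Strict Implicit.
Unset Printing Implicit Defensive.

Import Order.TTheory GRing.Theory Num.Theory.
Import numFieldNormedType.Exports.

(* Cards are the labels 1, ..., n : nat, and a deck is listed from the top.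
   One coin is tossed per card: the coin of card j is the value of
   e : {ffun 'I_n -> bool} at the ordinal of value j - 1, and it is true iff
   card j is placed at the top of the pile.  The coin of card n is irrelevant
   because the pile is then empty. *)
Definition shelf_shuffle (n : nat) (e : {ffun 'I_n -> bool}) : seq nat :=
  foldl (fun (pile : seq nat) (i : 'I_n) =>
           if e i then i.+1 :: pile else rcons pile i.+1)
        [::] (rev (enum 'I_n)).

(* A strategy maps the sequence of cards shown so far, in order of appearance,
   to the next guess.  [shown] accumulates that history while [deck] holds the
   cards still to be revealed. *)
Fixpoint correct_guesses (strategy : seq nat -> nat) (shown deck : seq nat)
    : nat :=
  if deck is c :: deck'
  then ((strategy shown == c) +
        correct_guesses strategy (rcons shown c) deck')%N
  else 0%N.

Definition largest_remaining (n : nat) (shown : seq nat) : nat :=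
  \max_(k <- iota 1 n | k \notin shown) k.

Local Open Scope ring_scope.

Definition nu {R : realType} (p : R) : int :=
  if 2^-1 <= p then 1 else Num.floor (ln p / ln (1 - p)) + 1.

(* Guessing the remaining cards in decreasing order means guessing, at each
   step, the largest label not yet shown.  For n = 1 the label n.-1 = 0 denotes
   no card, so that the first test only concerns card 1. *)
Definition optimal_strategy {R : realType} (p : R) (n : nat)
    (shown : seq nat) : nat :=
  if (n \in shown) || (n.-1 \in shown) then largest_remaining n shown
  else
    let j := last 0%N shown in
    if 2^-1 <= p then j.+1
    else if n%:Z - j%:Z <= nu p then n else j.+1.

Definition num_correct {R : realType} (p : R) (n : nat)
    (e : {ffun 'I_n -> bool}) : nat :=
  correct_guesses (optimal_strategy p n) [::] (shelf_shuffle e).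

(* Law of n independent Bernoulli(p) coins:
   [bernoulli_pmf p b] is p if b is true and 1 - p otherwise. *)
Definition coin_weight {R : realType} (p : R) (n : nat)
    (e : {ffun 'I_n -> bool}) : R :=
  \prod_(i < n) bernoulli_pmf p (e i).

Definition coin_prob {R : realType} (p : R) (n : nat)
    (A : pred {ffun 'I_n -> bool}) : R :=
  \sum_(e | A e) coin_weight p e.

Definition coin_expectation {R : realType} (p : R) (n : nat)
    (Y : {ffun 'I_n -> bool} -> R) : R :=
  \sum_e coin_weight p e * Y e.

Definition mean_correct {R : realType} (p : R) (n : nat) : R :=
  coin_expectation p (fun e : {ffun 'I_n -> bool} => (num_correct p e)%:R).

Definition variance_correct {R : realType} (p : R) (n : nat) : R :=
  coin_expectation p (fun e : {ffun 'I_n -> bool} =>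
    ((num_correct p e)%:R - mean_correct p n) ^+ 2).

Definition stddev_correct {R : realType} (p : R) (n : nat) : R :=
  Num.sqrt (variance_correct p n).

(* The index k is an integer because floor(mu_n + x sigma_n) may be negative;
   the probability is then 0. *)
Definition pmf_correct {R : realType} (p : R) (n : nat) (k : int) : R :=
  coin_prob p (fun e : {ffun 'I_n -> bool} => (num_correct p e)%:Z == k).

(* The supremum is taken in the extended reals, since the real-valued [sup] is
   0 on unbounded sets.  The bound is required for every n >= 1. *)
Definition gaussian_local_limit_law {R : realType}
    (mu sigma : nat -> R) (pmf : nat -> int -> R) (eps : nat -> R) : Prop :=
  forall n : nat, (0 < n)%N ->
    (ereal_sup (range (fun x : R =>
       `| sigma n * pmf n (Num.floor (mu n + x * sigma n))
          - (Num.sqrt (2 * pi))^-1 * expR (- (x ^+ 2 / 2)) |%:E))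
     <= (eps n)%:E)%E.

(* Main.v *)
Require Import Defs.
From mathcomp Require Import all_boot all_order all_algebra.
From mathcomp Require Import all_classical all_reals all_analysis.
From mathcomp Require Import measurable_realfun complex ring lra zify.

(** Read the coins in the order of the labels.  A card sent to the bottom is
    always guessed, in the final phase where the remaining cards come out in
    decreasing order; a card [j] sent to the top is guessed iff card [j - 1] was
    sent to the top too.  So, up to the last few cards, a point is lost exactly
    at each ascent (a bottom coin followed by a top coin), and [n - X_n] is the
    number of ascents plus a bounded term depending on boundedly many final
    coins ([score_ascents]).

    The number of ascents is an additive functional of a two-state chain.  With
    [q = 1 - p] and [u = cis t], its characteristic function is obtained by
    iterating the operator [twisted_step] on functions of the state, whose
    characteristic polynomial is [w^2 - w - p q (u - 1)].  Two facts control
    the iterates for [|t| <= 4], an interval that contains [-pi, pi].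
    - Two steps contract the sup norm by a factor [1 - c t^2]
      ([twisted_step2_le], [twisted_exp_decay]).
    - The Gaussian factor [w = exp(i p q t - v t^2 / 2)] with
      [v = p q (1 - 3 p q)] is a root of the polynomial up to [O(t^3)]
      ([gauss_factor_root]), and so has an approximate eigenvector.
    Summing the defect of this eigenvector along the iteration, each term being
    damped by the steps that follow, gives
    [|E exp(i t (n - X_n)) - w^n| <= C |t| exp(- c n t^2)]
    ([misses_characteristic]).  The final coins and the difference between the
    eigenvector and the constant function only change the left-hand side by
    [O(t)], which this error allows.

    Integrating over [0, pi] yields the probabilities up to [O(1/n)]
    ([pmf_gauss]), given the cosine transform of a Gaussian truncated to
    [0, pi]; that one satisfies the usual differential equation in the
    frequency up to an exponentially small term ([gauss_cosine_ode],
    [gauss_cosine_gauss]).  Multiplication by [sigma_n], of order [sqrt n],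
    leaves the rate [n^(-1/2)].  Finally a martingale shows that the mean of
    [X_n] is [n - p q n] up to [O(1)] and its variance [v n] up to [O(sqrt n)]
    ([moments_correct]), and replacing these approximations by the true moments
    moves the Gaussian density by [O(n^(-1/2))] only
    ([local_limit_transfer]). *)

Set Implicit Arguments.
Unset Strict Implicit.
Unset Printing Implicit Defensive.

Import Order.TTheory GRing.Theory Num.Theory.
Import numFieldNormedType.Exports.
Local Open Scope ring_scope.

(** * The guessing game as a function of the coins *)

(** Recursion on the smallest label, whose card is drawn last and therefore
    sits at one end of the pile: the top card of the deck becomes visible, which
    is the order in which the game is played. *)
Fixpoint pile_of (a : nat) (l : seq bool) : seq nat :=
  if l is c :: l'
  then if c then a.+1 :: pile_of a.+1 l' else rcons (pile_of a.+1 l') a.+1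
  else [::].

Lemma pile_of_foldr (a : nat) (l : seq bool) :
  foldr (fun i pile => if nth false l (i - a) then i.+1 :: pile
                       else rcons pile i.+1) [::] (iota a (size l))
  = pile_of a l.
Proof.
elim: l a => [//|c l IHl] a /=; rewrite subnn /= -IHl.
have eq_pile : foldr (fun i pile => if nth false (c :: l) (i - a)
      then i.+1 :: pile else rcons pile i.+1) [::] (iota a.+1 (size l)) =
    foldr (fun i pile => if nth false l (i - a.+1) then i.+1 :: pile
      else rcons pile i.+1) [::] (iota a.+1 (size l)).
  have: all (fun i => a < i)%N (iota a.+1 (size l)).
    by apply/allP => i; rewrite mem_iota => /andP[].
  elim: (iota _ _) => [//|i s IHs] /= /andP[ai as_]; rewrite IHs//.
  by rewrite -(ltn_predK ai) subSn ?subSS//; lia.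
by rewrite eq_pile.
Qed.

Lemma shelf_shuffleE (n : nat) (e : {ffun 'I_n -> bool}) :
  shelf_shuffle e = pile_of 0 [seq e i | i <- enum 'I_n].
Proof.
rewrite /shelf_shuffle foldl_rev -pile_of_foldr size_map size_enum_ord.
rewrite -val_enum_ord foldr_map.
elim: {-2}(enum 'I_n) => [//|i s IHs] /=; rewrite -IHs.
by rewrite subn0 (nth_map i) ?size_enum_ord// nth_ord_enum.
Qed.

Definition early_guess {R : realType} (p : R) (n j : nat) : nat :=
  if 2^-1 <= p then j.+1 else if n%:Z - j%:Z <= nu p then n else j.+1.

Lemma largest_remainingE (n : nat) (shown : seq nat) (c : nat) :
  (0 < c <= n)%N -> c \notin shown ->
  (forall k, (c < k <= n)%N -> k \in shown) -> largest_remaining n shown = c.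
Proof.
move=> /andP[c0 cn] cS above; apply/eqP; rewrite eqn_leq; apply/andP; split.
  apply/bigmax_leqP_seq => k; rewrite mem_iota => /andP[k0 kn] kS.
  by rewrite leqNgt; apply/negP => ck; move/negP: kS; apply; apply: above; lia.
by apply: leq_bigmax_seq => //; rewrite mem_iota; lia.
Qed.

(** The final phase: the largest remaining label is the first card of a
    decreasing deck that holds all the labels not shown, and it stays so after
    each guess. *)
Lemma guesses_decreasing {R : realType} (p : R) (n : nat)
    (shown deck : seq nat) :
  (n \in shown) || (n.-1 \in shown) -> sorted gtn deck ->
  (forall k, (k \in deck) = (0 < k <= n)%N && (k \notin shown)) ->
  correct_guesses (optimal_strategy p n) shown deck = size deck.
Proof.
elim: deck shown => [//|c deck IHd] shown key decr deckE /=.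
have /andP[c_n cS] : (0 < c <= n)%N && (c \notin shown).
  by rewrite -deckE mem_head.
have belowc k : k \in deck -> (k < c)%N.
  by move=> kd; have /allP := order_path_min (rev_trans ltn_trans) decr; apply.
rewrite {1}/optimal_strategy key (@largest_remainingE n shown c)//; last first.
  move=> k /andP[ck kn]; apply: contraT => kS.
  have: k \in c :: deck by rewrite deckE kS; lia.
  by rewrite inE => /predU1P[|/belowc]; lia.
rewrite eqxx add1n IHd//.
- by rewrite !mem_rcons !inE; move/orP: key => [->|->]; rewrite ?orbT.
- exact: path_sorted decr.
move=> k; rewrite mem_rcons inE negb_or andbCA -deckE inE.
by case: (eqVneq k c) => [->|//] /=; apply/negP => /belowc; rewrite ltnn.
Qed.

(** Points scored on the deck formed by the cards [a + 1, a + 2, ...] with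
    coins [l], when [j] is the last card shown and [g j] the guess made in that
    state.  A bottom card is credited as soon as its coin is read, although it
    is guessed only at the end; a top card just below the largest label opens
    the final phase, whence the last card is credited with certainty. *)
Fixpoint score (g : nat -> nat) (j a : nat) (l : seq bool) : nat :=
  if l is c :: l' then
    if l' is [::] then (g j == a.+1)%N
    else if c then
      ((g j == a.+1) + (if size l' == 1 then 1 else score g a.+1 a.+1 l'))%N
    else (score g j a.+1 l').+1
  else 0%N.

(** After the coins of cards [1, ..., a] have been read, the rest of the deck
    is the pile of the later cards followed by the list [d] of the cards among
    [1, ..., a] sent to the bottom, while [shown] lists those sent to the
    top. *)
Lemma correct_guesses_score {R : realType} (p : R) (j a : nat) (l : seq bool)
    (shown d : seq nat) (n := (a + size l)%N) :
  (0 < size l)%N -> n.-1 \notin shown -> last 0%N shown = j -> sorted gtn d ->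
  (forall k, (k \in shown) || (k \in d) = (0 < k <= a)%N) ->
  (forall k, k \in d -> k \notin shown) ->
  correct_guesses (optimal_strategy p n) shown (pile_of a l ++ d) =
  (score (early_guess p n) j a l + size d)%N.
Proof.
rewrite {}/n.
elim: l j a shown d => [//|c l IHl] j a shown d _.
set n := (a + _)%N => pred_n lastS decr shown_or_d d_shown.
have n_shown : n \notin shown.
  apply/negP => nS; have := shown_or_d n; rewrite nS /= /n /=; lia.
have early : optimal_strategy p n shown = early_guess p n j.
  by rewrite /optimal_strategy (negPf n_shown) (negPf pred_n) /= lastS.
have nE : (a.+1 + size l)%N = n by rewrite /n /=; lia.
have dlt k : k \in d -> (0 < k <= a)%N.
  by move=> kd; rewrite -shown_or_d kd orbT.
have Slt k : k \in shown -> (0 < k <= a)%N.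
  by move=> kd; rewrite -shown_or_d kd.
have aS : a.+1 \notin shown by apply/negP => /Slt; lia.
case: l IHl @n nE pred_n n_shown early => [|c' l'] IHl n nE pred_n n_shown early.
  have a1n : a.+1 = n by rewrite /n /=; lia.
  have -> : pile_of a [:: c] ++ d = a.+1 :: d by case: c {n nE a1n pred_n n_shown early}.
  rewrite /= early a1n guesses_decreasing//.
  - by rewrite mem_rcons inE eqxx.
  move=> k; rewrite mem_rcons inE negb_or -a1n.
  case: (eqVneq k a.+1) => [->|ka] /=.
    by rewrite andbF; apply/negP => /dlt; lia.
  have -> : (0 < k <= a.+1)%N = (0 < k <= a)%N by lia.
  rewrite -shown_or_d; have [kS|kS] /= := boolP (k \in shown).
    by apply/negP => /d_shown; rewrite kS.
  by rewrite andbT.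
move: IHl nE; set l := c' :: l' => IHl nE.
have sz_l : (0 < size l)%N by [].
case: c @n pred_n n_shown early nE => n pred_n n_shown early nE.
  have -> : pile_of a (true :: l) ++ d = a.+1 :: (pile_of a.+1 l ++ d) by [].
  have -> : score (early_guess p n) j a (true :: l) =
     ((early_guess p n j == a.+1) +
      (if size l == 1 then 1 else score (early_guess p n) a.+1 a.+1 l))%N by [].
  have -> : forall deck, correct_guesses (optimal_strategy p n) shown
      (a.+1 :: deck) = ((optimal_strategy p n shown == a.+1) +
      correct_guesses (optimal_strategy p n) (rcons shown a.+1) deck)%N by [].
  rewrite early -addnA; congr addn.
  have [l1|l1] := eqVneq (size l) 1%N.
    have -> : pile_of a.+1 l = [:: n].
      move: l1 nE; rewrite /l; case: (l') => //= _.
      by case: (c') => /=; rewrite addn1 => ->.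
    rewrite cat1s guesses_decreasing//=.
    - by rewrite !mem_rcons !inE -nE l1 addn1 /= eqxx orbT.
    - rewrite path_sortedE; last exact: rev_trans ltn_trans.
      rewrite decr andbT; apply/allP => k /dlt /=; rewrite -nE; lia.
    move=> k; rewrite mem_rcons !inE negb_or.
    case: (eqVneq k n) => [->|kn] /=.
      by rewrite n_shown andbT -nE; lia.
    case: (eqVneq k a.+1) => [->|ka] /=.
      by rewrite andbF; apply/negP => /dlt; lia.
    have -> : (0 < k <= n)%N = (0 < k <= a)%N by lia.
    rewrite -shown_or_d; have [kS|kS] /= := boolP (k \in shown).
      by apply/negP => /d_shown; rewrite kS.
    by rewrite andbT.
  rewrite -nE (IHl a.+1)//.
  - by rewrite mem_rcons inE negb_or nE pred_n andbT -nE; lia.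
  - by rewrite last_rcons.
  - move=> k; rewrite mem_rcons inE -orbA shown_or_d; lia.
  - move=> k kd; rewrite mem_rcons inE negb_or d_shown// andbT.
    by have := dlt _ kd; lia.
have -> : pile_of a (false :: l) ++ d = pile_of a.+1 l ++ a.+1 :: d.
  by rewrite /= cat_rcons.
have -> : score (early_guess p n) j a (false :: l) =
  (score (early_guess p n) j a.+1 l).+1 by [].
rewrite -nE (IHl j) ?nE//.
- by rewrite addSnnS.
- rewrite /= path_sortedE; last exact: rev_trans ltn_trans.
  by rewrite decr andbT; apply/allP => k /dlt /=; lia.
- move=> k; rewrite inE orbCA shown_or_d; lia.
- by move=> k; rewrite inE => /predU1P[->|/d_shown].
Qed.

Lemma num_correct_score {R : realType} (p : R) (n : nat)
    (e : {ffun 'I_n -> bool}) : (0 < n)%N ->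
  num_correct p e =
  score (early_guess p n) 0 0 [seq e i | i <- enum 'I_n].
Proof.
move=> n0; rewrite /num_correct shelf_shuffleE.
set l := map _ _; have sl : size l = n by rewrite size_map size_enum_ord.
have := @correct_guesses_score R p 0 0 l [::] [::].
rewrite add0n sl cats0 /= addn0 => -> //.
by move=> k; rewrite !in_nil; lia.
Qed.

Lemma score_le_size (g : nat -> nat) (j a : nat) (l : seq bool) :
  (score g j a l <= size l)%N.
Proof.
elim: l j a => [//|c l IHl] j a; case: l IHl => [|c' l] IHl; first exact: leq_b1.
set l' := c' :: l in IHl *.
case: c.
  have -> : score g j a (true :: l') =
     ((g j == a.+1) + (if size l' == 1 then 1 else score g a.+1 a.+1 l'))%N by [].
  have : ((if size l' == 1 then 1 else score g a.+1 a.+1 l') <= size l')%N.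
    by case: eqP => [->|].
  by case: (_ == _) => /=; lia.
by have := IHl j a.+1; rewrite /=; lia.
Qed.

(** If the last card shown is not [a], the guess [j + 1] names a card that is
    known to be at the bottom, so the exact value of [j] does not matter. *)
Lemma score_stale (g : nat -> nat) (j j' a : nat) (l : seq bool) :
  (j < a)%N -> (j' < a)%N -> g j = j.+1 -> g j' = j'.+1 ->
  score g j a l = score g j' a l.
Proof.
move=> + + gj gj'; elim: l a => [//|c l IHl] a ja j'a.
have ne i : (i < a)%N -> (i.+1 == a.+1) = false by lia.
case: l IHl => [_|c' l IHl]; first by rewrite /= gj gj' !ne.
rewrite /= in IHl *; case: c; first by rewrite gj gj' !ne.
by rewrite (IHl a.+1) //; lia.
Qed.

(** The state [b] is the coin before [l].  The game starts in state [true]: card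
    1 is guessed first, as if it followed a top card. *)
Fixpoint ascents (b : bool) (l : seq bool) : nat :=
  if l is c :: l' then ((~~ b && c) + ascents c l')%N else 0%N.

(** As long as the guess is [j + 1], every coin brings one point, except a top
    coin that follows a bottom coin.  The two or more coins in [l2] keep the
    final phase from starting before [l1] is exhausted; what [l2] retains of
    [l1] is only whether its last coin was a top one ([score_stale]). *)
Lemma score_cat (g : nat -> nat) (j a : nat) (l1 l2 : seq bool) :
  (1 < size l2)%N -> (j <= a)%N ->
  (forall i, (i < a + size l1)%N -> g i = i.+1) ->
  (score g j a (l1 ++ l2) + ascents (j == a) l1 =
   size l1 + score g (if last (j == a) l1 then a + size l1 else 0)
                     (a + size l1) l2)%N.
Proof.
move=> l2_gt1; elim: l1 j a => [|c l1 IHl] j a ja gE.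
  rewrite /= !addn0 add0n; case: eqVneq => [->//|ja'].
  by apply: score_stale; rewrite ?gE //=; lia.
have scoreS : score g j a ((c :: l1) ++ l2) =
    if c then ((j == a) + score g a.+1 a.+1 (l1 ++ l2))%N
    else (score g j a.+1 (l1 ++ l2)).+1.
  have : (1 < size (l1 ++ l2))%N by rewrite size_cat; lia.
  rewrite cat_cons /=; case: (l1 ++ l2) => [//|c' l' l'_gt1].
  have gj : g j = j.+1 by apply: gE; rewrite /=; lia.
  case: c {gE} => //; rewrite gj.
  by rewrite eqSS; move: l'_gt1 => /=; case: (size l').
rewrite scoreS /= !addnS -!addSn in gE *.
case: c {scoreS} gE => gE.
  have := IHl a.+1 a.+1 (leqnn _) gE.
  by rewrite eqxx; case: (j == a) => /=; lia.
have := IHl j a.+1 (leqW ja) gE.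
have -> : (j == a.+1) = false by lia.
rewrite /= andbF; lia.
Qed.

Lemma nu_bound {R : realType} (p : R) : exists K : nat, nu p <= K%:Z.
Proof. by exists `|nu p|%N; lia. Qed.

(** Any [k >= 2] above [nu p] works: a card [j < n - k] satisfies
    [n - j > nu p], hence the early guess is [j + 1] all along the first [n - k] coins. *)
Lemma score_ascents {R : realType} (p : R) :
  exists2 k : nat, (1 < k)%N &
  forall m : nat, exists2 D : bool -> seq bool -> nat,
    forall b l2, (D b l2 <= k)%N &
    forall l1 l2 : seq bool, size l1 = m -> size l2 = k ->
      (score (early_guess p (m + k)) 0 0 (l1 ++ l2) +
       (ascents true l1 + D (last true l1) l2) = m + k)%N.
Proof.
have [K nuK] := nu_bound p.
exists K.+2 => // m.
exists (fun b l2 => K.+2 - score (early_guess p (m + K.+2))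
                             (if b then m else 0) m l2)%N.
  by move=> b l2; rewrite leq_subr.
move=> l1 l2 sl1 sl2.
have := @score_cat (early_guess p (m + K.+2)) 0 0 l1 l2.
rewrite sl2 sl1 eqxx add0n => /(_ isT isT).
have gE i : (i < m)%N -> early_guess p (m + K.+2) i = i.+1.
  by move=> im; rewrite /early_guess; do 2 case: ifPn => //; lia.
move=> /(_ gE); set s := score _ _ m l2 => sE.
have : (s <= K.+2)%N by rewrite -sl2 score_le_size.
lia.
Qed.

(** * Expectation over the coins *)

(** Recursive form of [coin_expectation], over an arbitrary ring so as to serve
    both for real moments and for characteristic functions. *)
Fixpoint coin_exp {K : pzRingType} (p : K) (n : nat) (F : seq bool -> K) : K :=
  if n is n'.+1 then
    p * coin_exp p n' (fun l => F (true :: l)) +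
    (1 - p) * coin_exp p n' (fun l => F (false :: l))
  else F [::].

Lemma coin_expectation_exp {R : realType} (p : R) (n : nat)
    (F : seq bool -> R) :
  coin_expectation p (fun e : {ffun 'I_n -> bool} => F [seq e i | i <- enum 'I_n])
  = coin_exp p n F.
Proof.
rewrite /coin_expectation; elim: n F => [|n IHn] F /=.
  have e0 (e : {ffun 'I_0 -> bool}) : e = [ffun => true].
    by apply/ffunP => -[].
  rewrite (big_pred1 [ffun => true]); last first.
    by move=> e; rewrite (e0 e) /= eqxx.
  by rewrite /coin_weight big_ord0 mul1r enum_ord0.
pose glue (be : bool * {ffun 'I_n -> bool}) : {ffun 'I_n.+1 -> bool} :=
  [ffun i => if unlift ord0 i is Some j then be.2 j else be.1].
pose cut (e : {ffun 'I_n.+1 -> bool}) := (e ord0, [ffun j => e (lift ord0 j)]).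
have glueK : cancel glue cut.
  move=> [b e]; rewrite /cut /glue ffunE unlift_none; congr pair.
  by apply/ffunP => j; rewrite !ffunE liftK.
have cutK : cancel cut glue.
  move=> e; apply/ffunP => i; rewrite ffunE; case: unliftP => [j ->|->//] /=.
  by rewrite ffunE.
have glue0 be : glue be ord0 = be.1 by rewrite ffunE unlift_none.
have glueS be j : glue be (lift ord0 j) = be.2 j by rewrite ffunE liftK.
rewrite (reindex glue) /=; last by exists cut => e _.
rewrite -(pair_bigA _ (fun b e => coin_weight p (glue (b, e)) *
  F [seq glue (b, e) i | i <- enum 'I_n.+1])) /=.
rewrite big_bool /= -!IHn !mulr_sumr.
have termE b (e : {ffun 'I_n -> bool}) :
    coin_weight p (glue (b, e)) * F [seq glue (b, e) i | i <- enum 'I_n.+1] =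
    bernoulli_pmf p b * (coin_weight p e * F (b :: [seq e i | i <- enum 'I_n])).
  rewrite mulrA /coin_weight big_ord_recl glue0 enum_ordSl /= glue0 -map_comp.
  congr (_ * _ * F (_ :: _)); first by apply: eq_bigr => i _; rewrite glueS.
  by apply: eq_map => i /=; rewrite glueS.
by congr (_ + _); apply: eq_bigr => e _; rewrite termE.
Qed.

Section CoinExp.
Variables (K : comPzRingType) (p : K).

Lemma eq_coin_exp (n : nat) (F G : seq bool -> K) :
  (forall l, size l = n -> F l = G l) -> coin_exp p n F = coin_exp p n G.
Proof.
elim: n F G => [|n IHn] F G FG /=; first exact: FG.
by congr (_ * _ + _ * _); apply: IHn => l sl; apply: FG; rewrite /= sl.
Qed.

Lemma coin_expD (n : nat) (F G : seq bool -> K) :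
  coin_exp p n (fun l => F l + G l) = coin_exp p n F + coin_exp p n G.
Proof. by elim: n F G => [//|n IHn] F G /=; rewrite !IHn; ring. Qed.

Lemma coin_expZ (n : nat) (a : K) (F : seq bool -> K) :
  coin_exp p n (fun l => a * F l) = a * coin_exp p n F.
Proof. by elim: n F => [//|n IHn] F /=; rewrite !IHn; ring. Qed.

Lemma coin_exp_cst (n : nat) (a : K) : coin_exp p n (fun=> a) = a.
Proof. by elim: n => [//|n IHn] /=; rewrite !IHn; ring. Qed.

Lemma coin_exp_cat (m k : nat) (F : seq bool -> K) :
  coin_exp p (m + k) F =
  coin_exp p m (fun l1 => coin_exp p k (fun l2 => F (l1 ++ l2))).
Proof. by elim: m F => [//|m IHm] F /=; rewrite !IHm. Qed.

End CoinExp.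

Lemma ler_coin_exp {R : realDomainType} (p : R) (n : nat)
    (F G : seq bool -> R) : 0 <= p -> p <= 1 ->
  (forall l, size l = n -> F l <= G l) -> coin_exp p n F <= coin_exp p n G.
Proof.
move=> p0 p1; elim: n F G => [|n IHn] F G FG /=; first exact: FG.
have q0 : 0 <= 1 - p by lra.
by apply: lerD; apply: ler_wpM2l => //; apply: IHn => l sl; apply: FG;
  rewrite /= sl.
Qed.

(** * Mean and variance of the score *)

Section Moments.
Variables (R : realType) (p : R).
Local Notation q := (1 - p).

(** Solution of the Poisson equation of the coin chain for its ascents: this
    is what must be added to the centred number of ascents to get a
    martingale. *)
Definition corrector (b : bool) : R := if b then 0 else p.

Definition ascent_martingale (b : bool) (l : seq bool) : R :=
  (ascents b l)%:R - p * q * (size l)%:R + corrector (last b l).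

Lemma ascent_martingale_cons (b c : bool) (l : seq bool) :
  ascent_martingale b (c :: l) =
  (~~ b && c)%:R - p * q + ascent_martingale c l.
Proof.
by rewrite /ascent_martingale /= natrD -[in (size l).+1%:R]addn1 natrD; ring.
Qed.

Lemma mean_ascent_martingale (m : nat) (b : bool) (x : R) :
  coin_exp p m (fun l => x + ascent_martingale b l) = x + corrector b.
Proof.
elim: m b x => [|m IHm] b x /=.
  by rewrite /ascent_martingale /= mulr0 subr0 add0r.
have shift c : coin_exp p m (fun l => x + ascent_martingale b (c :: l)) =
    x + ((~~ b && c)%:R - p * q) + corrector c.
  rewrite -IHm; apply: eq_coin_exp => l _.
  by rewrite ascent_martingale_cons; ring.
rewrite !shift; clear shift; case: b; rewrite /corrector /=; ring.
Qed.

(** Average of [step_variance] over one coin, that is, the asymptotic variance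
    of the number of ascents per coin. *)
Definition ascent_variance : R := p * q * (1 - 3 * (p * q)).

(** Conditional variance of an increment of [ascent_martingale] after the
    coin [b]. *)
Definition step_variance (b : bool) : R :=
  if b then p ^+ 3 * q else p * q ^+ 3.

Lemma variance_ascent_martingale (m : nat) (b : bool) (x : R) :
  coin_exp p m.+1 (fun l => (x + ascent_martingale b l) ^+ 2) =
  (x + corrector b) ^+ 2 + step_variance b + ascent_variance * m%:R.
Proof.
elim: m b x => [|m IHm] b x.
  rewrite /= /ascent_martingale /=; case: b;
    by rewrite /corrector /step_variance /ascent_variance /=; ring.
rewrite [LHS]/=.
have shift c : coin_exp p m.+1 (fun l => (x + ascent_martingale b (c :: l)) ^+ 2)
    = (x + ((~~ b && c)%:R - p * q) + corrector c) ^+ 2 + step_variance c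
      + ascent_variance * m%:R.
  rewrite -IHm; apply: eq_coin_exp => l _.
  by rewrite ascent_martingale_cons; congr (_ ^+ 2); ring.
move: (shift true) (shift false) => /= -> ->.
rewrite -[in m.+1%:R]addn1 natrD.
clear shift; case: b; rewrite /corrector /step_variance /ascent_variance /=; ring.
Qed.

End Moments.

Section MomentsOfTheScore.
Variables (R : realType) (p : R).
Local Notation q := (1 - p).

(** The score is the opposite of the martingale [U] of the ascents, up to an
    affine function of [n] and a bounded term [B].  The cross term in the
    variance is controlled by [2 |U B| <= U^2 / sqrt n + sqrt n B^2]; the
    resulting error [O(sqrt n)] is just what [local_limit_transfer] admits. *)
Lemma moments_correct : 0 < p -> p < 1 ->
  exists2 K : R, 0 < K & exists N : nat, forall n : nat, (N <= n)%N ->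
    `|mean_correct p n - (n%:R - p * q * n%:R)| <= K /\
    `|variance_correct p n - ascent_variance p * n%:R| <= K * Num.sqrt n%:R.
Proof.
move=> p_gt0 p_lt1; have [k k_gt1 split_score] := score_ascents p.
pose K : R := 2 * k%:R + 1.
have k1 : (1 : R) <= k%:R by rewrite ler1n; lia.
have pq_ge0 : 0 <= p * q by apply: mulr_ge0; lra.
have pq_le : p * q <= 1 / 4 by have hsq := sqr_ge0 (p - 1 / 2); lra.
have pq_le1 : p * q <= 1 by lra.
pose K2 : R := 8 * K ^+ 2 + 2 + (k%:R + 2).
have K_ge1 : 1 <= K by rewrite /K; lra.
exists K2; first by rewrite /K2; nra.
exists k.+1 => n n_gt.
have [m0 nE] : exists m0, n = (m0.+1 + k)%N.
  by exists (n - k.+1)%N; lia.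
set m := m0.+1 in nE.
have [D D_le DE] := split_score m.
pose U (l : seq bool) := ascent_martingale p true (take m l).
pose B (l : seq bool) : R := (D (last true (take m l)) (drop m l))%:R
  - corrector p (last true (take m l)) - p * q * k%:R.
pose X (l : seq bool) : R := (score (early_guess p n) 0 0 l)%:R.
have XE l : size l = n -> X l = n%:R - p * q * n%:R - (U l + B l).
  move=> sl; have sm : size (take m l) = m by rewrite size_takel// sl nE leq_addr.
  have sk : size (drop m l) = k by rewrite size_drop sl nE addKn.
  have := DE (take m l) (drop m l) sm sk.
  rewrite cat_take_drop -nE => /(congr1 (fun i => i%:R : R)).
  rewrite !natrD /U /B /X /ascent_martingale sm => eq_n.
  have nR : n%:R = m%:R + k%:R :> R by rewrite nE natrD.
  by move: eq_n; rewrite nR => eq_n; lra.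
have B_le l : `|B l| <= K.
  have := D_le (last true (take m l)) (drop m l).
  rewrite -(ler_nat R) => D_k.
  have D_0 : (0 : R) <= (D (last true (take m l)) (drop m l))%:R by [].
  have [c0 c1] : 0 <= corrector p (last true (take m l)) /\
      corrector p (last true (take m l)) <= 1.
    by rewrite /corrector; case: ifP => _; split; lra.
  have k_ge0 : (0 : R) <= k%:R by [].
  have t1 : 0 <= p * q * k%:R by exact: mulr_ge0.
  have t2 : p * q * k%:R <= k%:R by exact: ler_piMl.
  by rewrite ler_norml /K /B; apply/andP; split; lra.
have meanU : coin_exp p n U = 0.
  rewrite nE coin_exp_cat (@eq_coin_exp _ _ _ _
    (fun l => 0 + ascent_martingale p true l)) ?mean_ascent_martingale ?addr0//.
  move=> l sl; rewrite -[RHS](coin_exp_cst p k); apply: eq_coin_exp => l' _.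
  by rewrite /U take_size_cat// add0r.
have varU : coin_exp p n (fun l => U l ^+ 2) =
    p ^+ 3 * q + ascent_variance p * m0%:R.
  rewrite nE coin_exp_cat (@eq_coin_exp _ _ _ _
    (fun l => (0 + ascent_martingale p true l) ^+ 2)).
    by rewrite variance_ascent_martingale /corrector /= addr0 expr0n add0r.
  move=> l sl; rewrite -[RHS](coin_exp_cst p k); apply: eq_coin_exp => l' _.
  by rewrite /U take_size_cat// add0r.
have n_gt0 : (0 < n)%N by lia.
have numE : forall e : {ffun 'I_n -> bool},
    (num_correct p e)%:R = X [seq e i | i <- enum 'I_n].
  by move=> e; rewrite num_correct_score.
clearbody U B.
have meanE : mean_correct p n = n%:R - p * q * n%:R - coin_exp p n B.
  rewrite /mean_correct.
  transitivity (coin_exp p n X).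
    rewrite -coin_expectation_exp; congr (coin_expectation _ _).
    by apply/funext => e; rewrite numE.
  rewrite (@eq_coin_exp _ _ _ _ (fun l => (n%:R - p * q * n%:R) +
    ((-1) * U l + (-1) * B l))); last first.
    by move=> l sl; rewrite XE//; ring.
  by rewrite coin_expD coin_exp_cst coin_expD !coin_expZ meanU; ring.
have EB_le : `|coin_exp p n B| <= K.
  rewrite ler_norml; apply/andP; split.
    rewrite -(coin_exp_cst p n (- K)); apply: ler_coin_exp; try lra.
    by move=> l _; have := B_le l; rewrite ler_norml => /andP[].
  rewrite -(coin_exp_cst p n K); apply: ler_coin_exp; try lra.
  by move=> l _; have := B_le l; rewrite ler_norml => /andP[].
split.
  rewrite meanE addrAC subrr add0r normrN (le_trans EB_le)// /K2; nra.
pose B' l := B l - coin_exp p n B.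
have B'_le l : `|B' l| <= 2 * K.
  by rewrite /B' (le_trans (ler_normB _ _))//; have hB := B_le l; lra.
have varE : variance_correct p n = coin_exp p n (fun l => (U l + B' l) ^+ 2).
  rewrite /variance_correct.
  transitivity (coin_exp p n (fun l => (X l - mean_correct p n) ^+ 2)).
    rewrite -coin_expectation_exp; congr (coin_expectation _ _).
    by apply/funext => e; rewrite numE.
  apply: eq_coin_exp => l sl; rewrite meanE XE// /B'; ring.
set s := Num.sqrt n%:R.
have s_ge1 : 1 <= s by rewrite -sqrtr1 ler_sqrt ?ler1n ?ltr0n.
have s2 : s ^+ 2 = n%:R by rewrite sqr_sqrtr.
(* Arithmetic-geometric mean inequality with weight [s]. *)
have cross l : `|(U l + B' l) ^+ 2 - U l ^+ 2| <= s^-1 * U l ^+ 2 + 8 * K ^+ 2 * s.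
  have := B'_le l; rewrite ler_norml => /andP[b1 b2].
  have bb : B' l ^+ 2 <= 4 * K ^+ 2 by nra.
  have s0 : 0 < s by lra.
  have ss : s * s^-1 = 1 by rewrite divff// gt_eqF.
  have si0 : 0 < s^-1 by rewrite invr_gt0.
  have sq1 : 0 <= s * (s^-1 * U l - B' l) ^+ 2 by rewrite mulr_ge0 ?sqr_ge0 ?ltW.
  have sq2 : 0 <= s * (s^-1 * U l + B' l) ^+ 2 by rewrite mulr_ge0 ?sqr_ge0 ?ltW.
  have e1 : s * (s^-1 * U l - B' l) ^+ 2 =
      s^-1 * U l ^+ 2 - 2 * U l * B' l + s * B' l ^+ 2.
    rewrite (_ : s * _ = (s * s^-1) * s^-1 * U l ^+ 2 -
      2 * (s * s^-1) * U l * B' l + s * B' l ^+ 2); last by ring.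
    by rewrite ss; ring.
  have e2 : s * (s^-1 * U l + B' l) ^+ 2 =
      s^-1 * U l ^+ 2 + 2 * U l * B' l + s * B' l ^+ 2.
    rewrite (_ : s * _ = (s * s^-1) * s^-1 * U l ^+ 2 +
      2 * (s * s^-1) * U l * B' l + s * B' l ^+ 2); last by ring.
    by rewrite ss; ring.
  have sb : s * B' l ^+ 2 <= 4 * K ^+ 2 * s by nra.
  have b0 : 0 <= B' l ^+ 2 by rewrite sqr_ge0.
  have KK : 4 * K ^+ 2 <= 4 * K ^+ 2 * s by rewrite ler_peMr// mulr_ge0 ?sqr_ge0.
  rewrite e1 in sq1; rewrite e2 in sq2.
  by rewrite ler_norml; apply/andP; split; lra.
have varU_n : `|coin_exp p n (fun l => U l ^+ 2) - ascent_variance p * n%:R|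
    <= k%:R + 2.
  rewrite varU nE /m natrD -[in m0.+1%:R]addn1 natrD.
  have v0 : 0 <= ascent_variance p by rewrite /ascent_variance; nra.
  have v1 : ascent_variance p <= 1 by rewrite /ascent_variance; nra.
  have p3 : 0 <= p ^+ 3 * q by rewrite mulr_ge0 ?exprn_ge0//; lra.
  have p31 : p ^+ 3 * q <= 1.
    by rewrite mulr_ile1 ?exprn_ge0 ?exprn_ile1//; lra.
  by rewrite ler_norml; apply/andP; split; nra.
have varU_le : coin_exp p n (fun l => U l ^+ 2) <= 2 * n%:R.
  move: varU_n; rewrite ler_norml => /andP[_].
  have v1 : ascent_variance p <= 1 / 4 by rewrite /ascent_variance; nra.
  have : (k%:R : R) + 1 <= n%:R by rewrite natr1 ler_nat.
  by nra.
have diff : `|variance_correct p n - coin_exp p n (fun l => U l ^+ 2)| <=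
    2 * s + 8 * K ^+ 2 * s.
  have -> : variance_correct p n - coin_exp p n (fun l => U l ^+ 2) =
      coin_exp p n (fun l => (U l + B' l) ^+ 2 - U l ^+ 2).
    rewrite varE (@eq_coin_exp _ _ _ (fun l => (U l + B' l) ^+ 2 - U l ^+ 2)
      (fun l => (U l + B' l) ^+ 2 + (-1) * U l ^+ 2)); last by move=> *; ring.
    by rewrite coin_expD coin_expZ; ring.
  have bound : coin_exp p n (fun l => s^-1 * U l ^+ 2 + 8 * K ^+ 2 * s) <=
      2 * s + 8 * K ^+ 2 * s.
    rewrite coin_expD coin_expZ coin_exp_cst lerD2r mulrC ler_pdivrMr; last lra.
    by rewrite -mulrA -expr2 s2.
  rewrite ler_norml; apply/andP; split.
    rewrite lerNl; apply: le_trans bound.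
    rewrite -mulN1r -coin_expZ; apply: ler_coin_exp; try lra.
    by move=> l _; have := cross l; rewrite ler_norml => /andP[]; lra.
  apply: le_trans bound; apply: ler_coin_exp; try lra.
  by move=> l _; have := cross l; rewrite ler_norml => /andP[]; lra.
rewrite (_ : variance_correct p n - _ =
  (variance_correct p n - coin_exp p n (fun l => U l ^+ 2)) +
  (coin_exp p n (fun l => U l ^+ 2) - ascent_variance p * n%:R)); last by ring.
apply: (le_trans (ler_normD _ _)); rewrite /K2.
by move: diff varU_n; nra.
Qed.

End MomentsOfTheScore.

(** * Taylor bounds for the real functions *)

Section Taylor.
Local Open Scope classical_set_scope.
Local Open Scope ring_scope.
Variable R : realType.
Implicit Types x y : R.

Lemma is_derive_within (f df : R -> R) (a b : R) :
  (forall y, is_derive y 1 f (df y)) ->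
  {within `[a, b], continuous f}.
Proof.
move=> fdf; apply: continuous_subspaceT => y.
by apply/differentiable_continuous/derivable1_diffP; have := fdf y; case.
Qed.

Lemma le_of_derive_ge0 (f df : R -> R) x :
  (forall y, is_derive y 1 f (df y)) -> (forall y, 0 <= y -> 0 <= df y) ->
  0 <= x -> f 0 <= f x.
Proof.
move=> fdf df0 x0.
have [c|c] := @MVT_segment R f df 0 x x0 (fun y _ => fdf y).
  exact: is_derive_within fdf c.
rewrite in_itv/= subr0 => /andP[c0 cx] E.
by rewrite -subr_ge0 E mulr_ge0// df0.
Qed.

Lemma sin_le x : 0 <= x -> sin x <= x.
Proof.
move=> x0; rewrite -subr_ge0.
have dF y : is_derive y 1 (fun y : R => y - sin y) (1 - cos y).
  exact: is_derive_eq.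
have := le_of_derive_ge0 dF _ x0; rewrite sin0 subr0; apply => y _.
by rewrite subr_ge0 cos_le1.
Qed.

Lemma cos_ge x : 1 - x ^+ 2 / 2 <= cos x.
Proof.
wlog x0 : x / 0 <= x.
  move=> hpos; have [/hpos//|x0] := leP 0 x.
  by have := hpos (- x); rewrite sqrrN cosN; apply; lra.
have dF y : is_derive y 1 (fun y : R => cos y - 1 + y ^+ 2 / 2) (y - sin y).
  by apply: is_derive_eq; rewrite /GRing.scale /=; field.
have := le_of_derive_ge0 dF _ x0; rewrite cos0 expr0n /= mul0r addr0 subrr.
have -> : (1 - x ^+ 2 / 2 <= cos x) = (0 <= cos x - 1 + x ^+ 2 / 2).
  by rewrite -subr_ge0; congr (_ <= _); ring.
by apply => y y0; rewrite subr_ge0 sin_le.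
Qed.

Lemma sin_ge x : 0 <= x -> x - x ^+ 3 / 6 <= sin x.
Proof.
move=> x0.
have dF y : is_derive y 1 (fun y : R => sin y - y + y ^+ 3 / 6)
    (cos y - 1 + y ^+ 2 / 2).
  by apply: is_derive_eq; rewrite /GRing.scale /=; field.
have := le_of_derive_ge0 dF _ x0; rewrite sin0 expr0n /= mul0r addr0 subrr.
have -> : (x - x ^+ 3 / 6 <= sin x) = (0 <= sin x - x + x ^+ 3 / 6).
  by rewrite -subr_ge0; congr (_ <= _); ring.
by apply => y y0; have hc := cos_ge y; lra.
Qed.

Lemma cos_le x : cos x <= 1 - x ^+ 2 / 2 + x ^+ 4 / 24.
Proof.
wlog x0 : x / 0 <= x.
  move=> hpos; have [/hpos//|x0] := leP 0 x.
  have := hpos (- x); rewrite cosN sqrrN (exprM (- x) 2 2) sqrrN -exprM.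
  by apply; lra.
have dF y : is_derive y 1 (fun y : R => 1 - y ^+ 2 / 2 + y ^+ 4 / 24 - cos y)
    (sin y - y + y ^+ 3 / 6).
  by apply: is_derive_eq; rewrite /GRing.scale /=; field.
have := le_of_derive_ge0 dF _ x0.
rewrite cos0 !expr0n /= !mul0r addr0 subr0 subrr subr_ge0.
by apply => y y0; have hs := sin_ge y0; lra.
Qed.

Lemma expRN_le x : 0 <= x -> expR (- x) <= 1 - x + x ^+ 2 / 2.
Proof.
move=> x0.
have dF y : is_derive y 1 (fun y : R => 1 - y + y ^+ 2 / 2 - expR (- y))
    (expR (- y) - 1 + y).
  by apply: is_derive_eq; rewrite /GRing.scale /=; field.
have := le_of_derive_ge0 dF _ x0.
rewrite oppr0 expR0 expr0n /= mul0r !addr0 subrr subr_ge0.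
by apply => y y0; have he := expR_ge1Dx (- y); lra.
Qed.

Lemma sin_taylor x : `|sin x - x| <= `|x| ^+ 3 / 6.
Proof.
have pos y : 0 <= y -> `|sin y - y| <= y ^+ 3 / 6.
  move=> y0; have h1 := sin_le y0; have h2 := sin_ge y0.
  by rewrite ler_norml; apply/andP; split; lra.
have [x0|x0] := leP 0 x; first by rewrite (ger0_norm x0) pos.
rewrite (ltr0_norm x0) -normrN opprD -sinN; apply: pos; lra.
Qed.

Lemma cos_taylor x : `|cos x - 1 + x ^+ 2 / 2| <= x ^+ 4 / 24.
Proof.
have h1 := cos_ge x; have h2 := cos_le x; rewrite ler_norml; apply/andP; split; last lra.
have h : 0 <= x ^+ 4 by rewrite (exprM x 2 2) sqr_ge0.
lra.
Qed.

Lemma norm_sin_le x : `|sin x| <= `|x|.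
Proof.
have pos y : 0 <= y -> `|sin y| <= y.
  move=> y0; have h1 := sin_le y0; rewrite ler_norml h1 andbT.
  have [y1|y1] := leP y 1; last by have := sin_geN1 y; lra.
  by have := @sin_ge y y0; nra.
have [x0|x0] := leP 0 x; first by rewrite (ger0_norm x0) pos.
by rewrite -normrN -sinN (ltr0_norm x0) pos; lra.
Qed.

Lemma norm_cosB1_le x : `|cos x - 1| <= `|x|.
Proof.
have c1 := cos_le1 x; have c2 := cos_geN1 x; have c3 := cos_ge x.
rewrite ler0_norm; last lra.
rewrite -real_normK ?num_real// in c3.
move: (`|x|) (normr_ge0 x) c3 => y y0 c3.
by have [y2|y2] := leP y 2; nra.
Qed.

(** Half-angle formula and [sin y >= y - y^3 / 6 >= y / 3] on [0, 2]. *)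
Lemma cos_gap x : `|x| <= 4 -> x ^+ 2 / 18 <= 1 - cos x.
Proof.
wlog x0 : x / 0 <= x.
  move=> hpos; have [/hpos//|x0] := leP 0 x.
  by have := hpos (- x); rewrite sqrrN cosN normrN; apply; lra.
rewrite ger0_norm// => x4.
have h := @sin_ge (x / 2); have {h} : x / 2 - (x / 2) ^+ 3 / 6 <= sin (x / 2).
  by apply: h; lra.
have -> : cos x = 1 - 2 * sin (x / 2) ^+ 2.
  have -> : x = (x / 2) *+ 2 by rewrite mulr2n; field.
  rewrite cos_mulr2n cos2sin2 (_ : (x / 2) *+ 2 / 2 = x / 2).
    by rewrite mulr2n; ring.
  by rewrite mulr2n; field.
move=> hs; have : x / 6 <= sin (x / 2).
  apply: le_trans hs; rewrite (_ : (x / 2) ^+ 3 / 6 = x * (x ^+ 2 / 48)); last by field.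
  have : x ^+ 2 <= 16 by nra.
  nra.
by move=> h6; nra.
Qed.

End Taylor.

(** * Unit complex numbers *)

Section Cis.
Local Open Scope complex_scope.
Variable R : realType.
Implicit Types (x y t : R) (z : R[i]).
Local Notation normc := (@Normc.normc R).

Definition cis x : R[i] := cos x +i* sin x.

Lemma cis0 : cis 0 = 1.
Proof. by rewrite /cis cos0 sin0. Qed.

Lemma cisD x y : cis (x + y) = cis x * cis y.
Proof.
apply/eqP; rewrite eq_complex /= cosD sinD.
by apply/andP; split; apply/eqP; ring.
Qed.

Lemma cisMn x n : cis (x * n%:R) = cis x ^+ n.
Proof.
elim: n => [|n IHn]; first by rewrite mulr0 cis0.
by rewrite -natr1 mulrDr mulr1 cisD IHn exprSr.
Qed.

Lemma normc_ge0 z : 0 <= normc z.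
Proof. by case: z => a b; exact: sqrtr_ge0. Qed.

Lemma normc_real x : normc x%:C = `|x|.
Proof. by rewrite /= expr0n addr0 sqrtr_sqr. Qed.

Lemma normc_cis x : normc (cis x) = 1.
Proof. by rewrite /= cos2Dsin2 sqrtr1. Qed.

Lemma ler_normcD (z1 z2 : R[i]) : normc (z1 + z2) <= normc z1 + normc z2.
Proof. exact: le_normcD. Qed.

Lemma normc_opp z : normc (- z) = normc z.
Proof. exact: normcN. Qed.

Lemma normcX z n : normc (z ^+ n) = normc z ^+ n.
Proof.
elim: n => [|n IHn]; first by rewrite !expr0 Normc.normc1.
by rewrite !exprS Normc.normcM IHn.
Qed.

Lemma normc_le_ReIm z : normc z <= `|complex.Re z| + `|complex.Im z|.
Proof.
case: z => a b /=; have ab0 := addr_ge0 (normr_ge0 a) (normr_ge0 b).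
rewrite -(ger0_norm ab0) -sqrtr_sqr ler_wsqrtr// sqrrD !real_normK ?num_real//.
by rewrite addrAC lerDl mulrn_wge0// mulr_ge0.
Qed.

Lemma Re_le_normc z : `|complex.Re z| <= normc z.
Proof.
case: z => a b /=; rewrite -sqrtr_sqr ler_wsqrtr// lerDl.
exact: sqr_ge0.
Qed.

Lemma normc_cisB1 x : normc (cis x - 1) <= 2 * `|x|.
Proof.
apply: (le_trans (normc_le_ReIm _)); rewrite /= subr0.
have h1 := norm_sin_le x; have h2 := norm_cosB1_le x; lra.
Qed.

(** With [x] of order [t] and [y] of order [t^2], the terms kept are those of
    order at most 2 in [t]. *)
Lemma expcis_taylor x y t : `|x| <= `|t| -> 0 <= y -> y <= t ^+ 2 / 2 ->
  `|t| <= 8 ->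
  normc ((expR (- y))%:C * cis x - ((1 - x ^+ 2 / 2 - y) +i* x))
  <= 15 * `|t| ^+ 3.
Proof.
move=> xt y0 yt t8; apply: (le_trans (normc_le_ReIm _)) => /=.
set E := expR (- y); rewrite !mul0r subr0 addr0.
have E1 : E <= 1 by rewrite -expR0 ler_expR; lra.
have E0 : 0 <= E by exact: expR_ge0.
have E2 : E <= 1 - y + y ^+ 2 / 2 by exact: expRN_le.
have E3 : 1 - y <= E by have h := expR_ge1Dx (- y); rewrite /E; lra.
have c4 := cos_taylor x; have s3 := sin_taylor x.
have x4 : x ^+ 4 = `|x| ^+ 4.
  by rewrite (exprM `|x| 2 2) real_normK ?num_real// -exprM.
have x2 : x ^+ 2 = `|x| ^+ 2 by rewrite real_normK ?num_real.
have t2 : t ^+ 2 = `|t| ^+ 2 by rewrite real_normK ?num_real.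
rewrite x4 in c4; rewrite t2 in yt.
move: (normr_ge0 x) (normr_ge0 t) => X0 T0.
have ReE : E * cos x - (1 - x ^+ 2 / 2 - y) =
  (E - 1 + y) * cos x + (1 - y) * (cos x - 1 + x ^+ 2 / 2) + y * (x ^+ 2 / 2).
  by field.
have ImE : E * sin x - x = E * (sin x - x) + x * (E - 1) by ring.
set T := `|t| in xt t8 T0 yt *.
have T3 : 0 <= T ^+ 3 by exact: exprn_ge0.
have xT2 : `|x| ^+ 2 <= T ^+ 2 by rewrite ler_pXn2r ?nnegrE.
have xT3 : `|x| ^+ 3 <= T ^+ 3 by rewrite ler_pXn2r ?nnegrE.
have xT4 : `|x| ^+ 4 <= T ^+ 4 by rewrite ler_pXn2r ?nnegrE.
have T43 : T ^+ 4 <= 8 * T ^+ 3 by rewrite exprS ler_wpM2r.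
have Y2 : y ^+ 2 <= T ^+ 4 / 4.
  have : y * y <= (T ^+ 2 / 2) * (T ^+ 2 / 2) by apply: ler_pM.
  by rewrite -!expr2 exprMn -exprM exprVn; lra.
have T64 : T ^+ 2 <= 64 by nra.
have y32 : y <= 32 by lra.
have n1 : `|(E - 1 + y) * cos x| <= T ^+ 4 / 8.
  rewrite normrM -[leRHS]mulr1; apply: ler_pM => //; last exact: cos_max.
  by rewrite ler_norml; lra.
have n2 : `|(1 - y) * (cos x - 1 + x ^+ 2 / 2)| <= 33 * (T ^+ 4 / 24).
  rewrite normrM; apply: ler_pM => //; first by rewrite ler_norml; lra.
  by lra.
have n3 : `|y * (x ^+ 2 / 2)| <= T ^+ 4 / 4.
  have : y * (`|x| ^+ 2 / 2) <= (T ^+ 2 / 2) * (T ^+ 2 / 2).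
    by apply: ler_pM => //; lra.
  have p0 : 0 <= y * (x ^+ 2 / 2) by rewrite mulr_ge0// divr_ge0// sqr_ge0.
  rewrite (ger0_norm p0) x2.
  rewrite (_ : T ^+ 2 / 2 * (T ^+ 2 / 2) = T ^+ 4 / 4) //; by field.
have n4 : `|E * (sin x - x)| <= T ^+ 3 / 6.
  rewrite normrM -[leRHS]mul1r; apply: ler_pM => //; last lra.
  by rewrite ger0_norm.
have n5 : `|x * (E - 1)| <= T * (T ^+ 2 / 2).
  rewrite normrM; apply: ler_pM => //.
  by rewrite ler0_norm; lra.
have TT : T * (T ^+ 2 / 2) = T ^+ 3 / 2 by field.
rewrite ReE ImE.
have m1 := ler_normD
  ((E - 1 + y) * cos x + (1 - y) * (cos x - 1 + x ^+ 2 / 2)) (y * (x ^+ 2 / 2)).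
have m2 := ler_normD ((E - 1 + y) * cos x) ((1 - y) * (cos x - 1 + x ^+ 2 / 2)).
have m3 := ler_normD (E * (sin x - x)) (x * (E - 1)).
lra.
Qed.

End Cis.

(** * The twisted coin chain *)

Section TwistedChain.
Local Open Scope complex_scope.
Variables (R : realType) (p : R).
Local Notation normc := (@Normc.normc R).
Local Notation q := (1 - p).
Local Notation P := (p%:C).
Local Notation Q := (1 - P).
Implicit Types (u : R[i]) (H : bool -> R[i]) (b : bool).

(** Joint transform of the number of ascents in [b :: l], tested by [u], and of
    the final coin, tested by [H]. *)
Definition twisted_exp u H (m : nat) b : R[i] :=
  coin_exp P m (fun l => u ^+ ascents b l * H (last b l)).

Definition twisted_step u H b : R[i] :=
  P * (u ^+ (~~ b) * H true) + Q * H false.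

Lemma twisted_expS u H m b :
  twisted_exp u H m.+1 b = twisted_step u (twisted_exp u H m) b.
Proof.
rewrite /twisted_exp /twisted_step /=; congr (_ * _ + _ * _).
  rewrite -coin_expZ; by apply: eq_coin_exp => l _; rewrite andbT exprD mulrA.
by apply: eq_coin_exp => l _; rewrite andbF.
Qed.

(** The last coin can be averaged out first: this form lets an identity on
    [twisted_step u H] propagate through the iteration. *)
Lemma twisted_expSr u H m b :
  twisted_exp u H m.+1 b = twisted_exp u (twisted_step u H) m b.
Proof.
elim: m b => [|m IHm] b; last first.
  rewrite twisted_expS [RHS]twisted_expS.
  by rewrite /twisted_step !IHm.
by rewrite twisted_expS /twisted_exp /twisted_step /= !mul1r.
Qed.

Lemma twisted_expZ u a H m b :
  twisted_exp u (fun b => a * H b) m b = a * twisted_exp u H m b.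
Proof.
by rewrite /twisted_exp -coin_expZ; apply: eq_coin_exp => l _; rewrite mulrCA.
Qed.

Lemma twisted_expD u H1 H2 m b :
  twisted_exp u (fun b => H1 b + H2 b) m b =
  twisted_exp u H1 m b + twisted_exp u H2 m b.
Proof.
by rewrite /twisted_exp -coin_expD; apply: eq_coin_exp => l _; rewrite mulrDr.
Qed.

Hypotheses (p_gt0 : 0 < p) (p_lt1 : p < 1).

Let QE : Q = q%:C. Proof. by rewrite rmorphB rmorph1. Qed.

Lemma normc_weights (z1 z2 : R[i]) :
  normc (P * z1 + Q * z2) <= p * normc z1 + q * normc z2.
Proof.
rewrite QE; apply: (le_trans (ler_normcD _ _)).
have p0 := ltW p_gt0; have q0 : 0 <= q by move: p_lt1; lra.
by rewrite !Normc.normcM !normc_real !ger0_norm.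
Qed.

Lemma twisted_step_le u H (h : R) : normc u = 1 ->
  (forall b, normc (H b) <= h) -> forall b, normc (twisted_step u H b) <= h.
Proof.
move=> u1 Hh b; apply: (le_trans (normc_weights _ _)).
rewrite Normc.normcM normcX u1 expr1n mul1r.
have := p_gt0; have := p_lt1; have := Hh true; have := Hh false => h1 h2 h3 h4.
have k1 : p * normc (H true) <= p * h by rewrite ler_wpM2l// ltW.
have k2 : q * normc (H false) <= q * h by rewrite ler_wpM2l//; lra.
by lra.
Qed.

(** One step need not contract, but the two ways to return to a state after
    two steps differ by one ascent, so that their contributions add up to
    [P + Q u] or [P u + Q] instead of 1. *)
Lemma twisted_step2_le u H (r h : R) : normc u = 1 ->
  normc (P + Q * u) <= r -> normc (P * u + Q) <= r -> r <= 1 ->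
  (forall b, normc (H b) <= h) ->
  forall b, normc (twisted_step u (twisted_step u H) b) <=
            (1 - p * q * (1 - r)) * h.
Proof.
move=> u1 r1 r2 r_le1 Hh b.
have h0 : 0 <= h by rewrite (le_trans _ (Hh true))// normc_ge0.
have rr : 0 <= r by rewrite (le_trans _ r1)// normc_ge0.
have := p_gt0; have := p_lt1; have := Hh true; have := Hh false => h1 h2 h3 h4.
have q0 : 0 < q by lra.
have key1 : p * (r * h) + q * h <= (1 - p * q * (1 - r)) * h.
  rewrite -subr_ge0 (_ : _ - _ = p * p * (1 - r) * h); last by ring.
  by rewrite !mulr_ge0//; lra.
have key2 : p * h + q * (r * h) <= (1 - p * q * (1 - r)) * h.
  rewrite -subr_ge0 (_ : _ - _ = q * q * (1 - r) * h); last by ring.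
  by rewrite !mulr_ge0//; lra.
case: b.
  have -> : twisted_step u (twisted_step u H) true =
      P * ((P + Q * u) * H true) + Q * H false.
    by rewrite /twisted_step /=; ring.
  apply: (le_trans (normc_weights _ _)); apply: le_trans key1.
  rewrite Normc.normcM; apply: lerD; rewrite ler_wpM2l//; try lra.
  by apply: ler_pM => //; exact: normc_ge0.
have -> : twisted_step u (twisted_step u H) false =
    P * (u * H true) + Q * ((P * u + Q) * H false).
  by rewrite /twisted_step /=; ring.
apply: (le_trans (normc_weights _ _)); apply: le_trans key2.
rewrite !Normc.normcM u1 mul1r; apply: lerD; rewrite ler_wpM2l//; try lra.
by apply: ler_pM => //; exact: normc_ge0.
Qed.

Lemma twisted_exp_le u H (r h : R) m b : normc u = 1 ->
  normc (P + Q * u) <= r -> normc (P * u + Q) <= r -> r <= 1 ->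
  (forall b, normc (H b) <= h) ->
  normc (twisted_exp u H m b) <= (1 - p * q * (1 - r)) ^+ m./2 * h.
Proof.
move=> u1 r1 r2 r_le1 Hh.
have exp0 b' : twisted_exp u H 0 b' = H b' by rewrite /twisted_exp /= mul1r.
elim/ltn_ind: m b => -[|[|m]] IHm b.
- by rewrite exp0 expr0 mul1r.
- rewrite twisted_expS expr0 mul1r; apply: twisted_step_le => // b'.
  by rewrite exp0.
rewrite twisted_expS.
have -> : twisted_step u (twisted_exp u H m.+1) b =
    twisted_step u (twisted_step u (twisted_exp u H m)) b.
  by rewrite /twisted_step !twisted_expS.
rewrite /= exprS -mulrA; apply: twisted_step2_le => // b'.
exact: IHm.
Qed.

End TwistedChain.

Section Characteristic.
Local Open Scope complex_scope.
Variables (R : realType) (p : R).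
Hypotheses (p_gt0 : 0 < p) (p_lt1 : p < 1).
Local Notation normc := (@Normc.normc R).
Local Notation q := (1 - p).
Local Notation P := (p%:C).
Local Notation Q := (1 - P).

(** The square of both moduli is [1 - 2 p q (1 - cos t)]. *)
Lemma normc_two_point (t : R) : `|t| <= 4 ->
  normc (P + Q * cis t) <= 1 - p * q * (t ^+ 2 / 18) /\
  normc (P * cis t + Q) <= 1 - p * q * (t ^+ 2 / 18).
Proof.
move: p_gt0 p_lt1 => p0 p1 t4; have gap := cos_gap t4.
have pq0 : 0 <= p * q by rewrite mulr_ge0//; lra.
have pq1 : p * q <= 1 / 4 by have hsq := sqr_ge0 (p - 1 / 2); lra.
have t16 : t ^+ 2 <= 16.
  rewrite -real_normK ?num_real// (_ : 16 = 4 ^+ 2); last by ring.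
  by rewrite ler_pXn2r ?nnegrE.
have t0 := sqr_ge0 t.
have big : 0 <= 1 - p * q * (t ^+ 2 / 18) by nra.
have QE : Q = q%:C by rewrite rmorphB rmorph1.
have sc := cos2Dsin2 t.
set B := 1 - p * q * (t ^+ 2 / 18) in big *.
have sqrt_le a : a <= B ^+ 2 -> Num.sqrt a <= B.
  by move=> aB; rewrite -(ger0_norm big) -sqrtr_sqr ler_wsqrtr.
rewrite QE /=.
have main : p * p + q * q + 2 * (p * q) * cos t <= B ^+ 2.
  have : p * q * (t ^+ 2 / 18) <= p * q * (1 - cos t) by rewrite ler_wpM2l.
  have s0 := sqr_ge0 (p * q * (t ^+ 2 / 18)).
  by rewrite /B => main; lra.
split; apply: sqrt_le; apply: le_trans main;
  rewrite ?(mul0r, mulr0, subr0, addr0, add0r);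
  rewrite le_eqVlt; apply/orP; left; apply/eqP.
- rewrite (_ : (_ + _) ^+ 2 + _ = p * p + 2 * (p * q) * cos t + q * q *
    (cos t ^+ 2 + sin t ^+ 2)); last by ring.
  by rewrite sc; ring.
- rewrite (_ : (_ + _) ^+ 2 + _ = q * q + 2 * (p * q) * cos t + p * p *
    (cos t ^+ 2 + sin t ^+ 2)); last by ring.
  by rewrite sc; ring.
Qed.

(** Exponent per step: a pair of steps contracts by [1 - (p q)^2 t^2 / 18],
    with the constant 18 of [cos_gap]. *)
Definition decay : R := (p * q) ^+ 2 / 36.

Lemma decay_gt0 : 0 < decay.
Proof.
by rewrite /decay divr_gt0// exprn_gt0// mulr_gt0// subr_gt0.
Qed.

(** The factor [expR (16 * decay)] pays for the unpaired step when [m] is odd,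
    as [t^2 <= 16]. *)
Lemma twisted_exp_decay (t h : R) (H : bool -> R[i]) (m : nat) (b : bool) :
  `|t| <= 4 -> (forall b, normc (H b) <= h) ->
  normc (twisted_exp p (cis t) H m b) <=
  expR (16 * decay) * expR (- (decay * t ^+ 2 * m%:R)) * h.
Proof.
move=> t4 Hh.
have h0 : 0 <= h by rewrite (le_trans _ (Hh true))// normc_ge0.
have pq0 : 0 <= p * q by rewrite mulr_ge0// ?subr_ge0 ltW.
have pq1 : p * q <= 1 / 4 by have hsq := sqr_ge0 (p - 1 / 2); lra.
have t16 : t ^+ 2 <= 16.
  rewrite -real_normK ?num_real// (_ : 16 = 4 ^+ 2); last by ring.
  by rewrite ler_pXn2r ?nnegrE.
have t0 := sqr_ge0 t.
have [r1 r2] := normc_two_point t4.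
apply: (le_trans (@twisted_exp_le R p p_gt0 p_lt1 _ _ _ h m b _ r1 r2 _ Hh)).
- exact: normc_cis.
- by rewrite lerBlDr lerDl mulr_ge0// divr_ge0.
rewrite ler_wpM2r//.
have -> : 1 - p * q * (1 - (1 - p * q * (t ^+ 2 / 18))) = 1 - 2 * decay * t ^+ 2.
  by rewrite /decay; field.
have dec0 := decay_gt0.
have dec1 : decay * t ^+ 2 <= 1 / 2.
  have pq2 : (p * q) ^+ 2 <= 1 by rewrite exprn_ile1//; lra.
  have : decay * t ^+ 2 <= 1 / 36 * 16.
    by apply: ler_pM => //; [exact: ltW | rewrite /decay; lra].
  by lra.
apply: (@le_trans _ _ (expR (- (2 * decay * t ^+ 2)) ^+ m./2)).
  apply: lerXn2r; rewrite ?nnegrE ?expR_ge0//; first lra.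
  by have he := expR_ge1Dx (- (2 * decay * t ^+ 2)); lra.
rewrite -expRM_natr -expRD ler_expR.
have m_half : m%:R <= 2 * (m./2)%:R + 1 :> R.
  rewrite -natrM natr1 ler_nat -{1}(odd_double_half m) mul2n addnC -addn1.
  by rewrite leq_add2l leq_b1.
have : decay * t ^+ 2 * m%:R <= decay * t ^+ 2 * (2 * (m./2)%:R + 1).
  by rewrite ler_wpM2l// mulr_ge0// ltW.
have : decay * t ^+ 2 <= decay * 16 by rewrite ler_wpM2l// ltW.
lra.
Qed.

End Characteristic.

(** * Gaussian approximation of the twisted chain *)

Lemma quasi_eigenvector_true (K : fieldType) (P u w : K) : 1 - P != 0 ->
  P * (u ^+ 0 * 1) + (1 - P) * ((w - P) / (1 - P)) - w * 1 = 0.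
Proof. by move=> Q0; field. Qed.

Lemma quasi_eigenvector_false (K : fieldType) (P u w : K) : 1 - P != 0 ->
  P * (u ^+ 1 * 1) + (1 - P) * ((w - P) / (1 - P)) - w * ((w - P) / (1 - P)) =
  - ((w ^+ 2 - w - P * (1 - P) * (u - 1)) / (1 - P)).
Proof. by move=> Q0; field. Qed.

Section QuasiEigenvector.
Local Open Scope complex_scope.
Variables (R : realType) (p : R).
Hypotheses (p_gt0 : 0 < p) (p_lt1 : p < 1).
Local Notation normc := (@Normc.normc R).
Local Notation q := (1 - p).
Local Notation P := (p%:C).
Local Notation Q := (1 - P).
Local Notation v := (ascent_variance p).
Local Notation d := (decay p).
Implicit Types (t : R) (b : bool) (m : nat).

Definition gauss_factor t : R[i] :=
  (expR (- (v * t ^+ 2 / 2)))%:C * cis (p * q * t).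

Let pq_gt0 : 0 < p * q. Proof. by rewrite mulr_gt0// subr_gt0. Qed.
Let pq_le : p * q <= 1 / 4.
Proof. by have hsq := sqr_ge0 (p - 1 / 2); lra. Qed.

Lemma ascent_variance_bounds : p * q / 4 <= v /\ v <= 1 / 4.
Proof.
rewrite /ascent_variance; move: pq_gt0 pq_le; set a := p * q => a0 a1; split.
  have a2 : 0 <= a * (1 / 4 - a) by apply: mulr_ge0; lra.
  lra.
have : 0 <= a * a by rewrite mulr_ge0 ?ltW.
lra.
Qed.

Lemma sqr_le16 t : `|t| <= 4 -> t ^+ 2 <= 16.
Proof.
move=> t4; rewrite -real_normK ?num_real// (_ : 16 = 4 ^+ 2); last by ring.
by rewrite ler_pXn2r ?nnegrE.
Qed.

Lemma normc_gauss_factor t : normc (gauss_factor t) <= expR (- (d * t ^+ 2)).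
Proof.
rewrite Normc.normcM normc_real normc_cis mulr1 ger0_norm ?expR_ge0// ler_expR.
have [v0 _] := ascent_variance_bounds.
have : 2 * d <= v.
  rewrite /decay; move: pq_gt0 pq_le v0; set a := p * q => a0 a1 v0.
  have : a * a <= a * (1 / 4) by rewrite ler_wpM2l// ltW.
  by rewrite expr2; lra.
move=> dv; have : 2 * d * t ^+ 2 <= v * t ^+ 2 by rewrite ler_wpM2r ?sqr_ge0.
lra.
Qed.

Lemma gauss_factorB1 t : `|t| <= 4 -> normc (gauss_factor t - 1) <= 4 * `|t|.
Proof.
move=> t4; have [v0 v1] := ascent_variance_bounds; rewrite /gauss_factor.
have pq0 := pq_gt0; have pq1 := pq_le.
set y := v * t ^+ 2 / 2; set a := p * q * t.
have t0 := normr_ge0 t.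
have v_ge0 : 0 <= v by lra.
have y0 : 0 <= y by rewrite /y divr_ge0// mulr_ge0// sqr_ge0.
have y1 : y <= `|t|.
  have : v * t ^+ 2 <= 1 / 4 * t ^+ 2 by rewrite ler_wpM2r ?sqr_ge0.
  rewrite -(real_normK (num_real t)) /y -(real_normK (num_real t)).
  move: t0 t4; set T := `|t| => t0 t4 ; rewrite expr2.
  have : T * T <= 4 * T by rewrite ler_wpM2r.
  lra.
have a1 : `|a| <= `|t|.
  by rewrite normrM ler_piMl// ger0_norm; lra.
have E0 : 1 - y <= expR (- y) by have he := expR_ge1Dx (- y); lra.
have E1 : expR (- y) <= 1 by rewrite -expR0 ler_expR; lra.
rewrite (_ : _ - 1 = (expR (- y))%:C * (cis a - 1) + (expR (- y) - 1)%:C);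
  last by rewrite rmorphB rmorph1; ring.
apply: (le_trans (ler_normcD _ _)); rewrite Normc.normcM !normc_real.
rewrite (ger0_norm (expR_ge0 _)) (ler0_norm (_ : _ - 1 <= 0)); last lra.
have c := normc_cisB1 a.
have : expR (- y) * normc (cis a - 1) <= 1 * (2 * `|t|).
  by apply: ler_pM; rewrite ?expR_ge0 ?normc_ge0//; lra.
by lra.
Qed.

(** The linear terms in [t] cancel because the drift is [p q], the quadratic
    ones because the variance is [ascent_variance p]. *)
Lemma gauss_factor_root t : `|t| <= 4 ->
  normc (gauss_factor t ^+ 2 - gauss_factor t - (p * q)%:C * (cis t - 1))
  <= 150 * `|t| ^+ 3.
Proof.
move=> t4; have [v0 v1] := ascent_variance_bounds.
set a := p * q in v0 *.
have a0 : 0 < a := pq_gt0; have a1 : a <= 1 / 4 := pq_le.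
have aE : a = p * q by []; clearbody a.
have v_ge0 : 0 <= v by lra.
have v_le1 : v <= 1 by lra.
have t2 := sqr_ge0 t.
have T1 : normc (gauss_factor t -
   ((1 - (a * t) ^+ 2 / 2 - v * t ^+ 2 / 2) +i* (a * t))) <= 15 * `|t| ^+ 3.
  rewrite /gauss_factor -aE; apply: expcis_taylor.
  - by rewrite normrM ler_piMl// ger0_norm; lra.
  - by rewrite divr_ge0// mulr_ge0.
  - by rewrite ler_wpM2r// ler_piMl.
  - lra.
have sqrE : gauss_factor t ^+ 2 =
    (expR (- (v * t ^+ 2)))%:C * cis (a * (2 * t)).
  rewrite /gauss_factor -aE exprMn -rmorphXn -expRM_natl -cisMn.
  by congr ((expR _)%:C * cis _); field.
have T2 : normc (gauss_factor t ^+ 2 -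
   ((1 - (a * (2 * t)) ^+ 2 / 2 - v * t ^+ 2) +i* (a * (2 * t))))
   <= 15 * `|2 * t| ^+ 3.
  rewrite sqrE; apply: expcis_taylor.
  - by rewrite normrM ler_piMl// ger0_norm; lra.
  - by rewrite mulr_ge0.
  - have : v * t ^+ 2 <= 1 * t ^+ 2 by rewrite ler_wpM2r.
    by rewrite exprMn; lra.
  - by rewrite normrM ger0_norm//; lra.
have T3 : normc (cis t - ((1 - t ^+ 2 / 2) +i* t)) <= 15 * `|t| ^+ 3.
  have := @expcis_taylor R t 0 t (lexx _) (lexx _) _ _.
  rewrite oppr0 expR0 mul1r addr0; apply; last lra.
  by rewrite mulr_ge0.
have e8 : `|2 * t| ^+ 3 = 8 * `|t| ^+ 3.
  by rewrite normrM (ger0_norm (_ : 0 <= 2))//; ring.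
rewrite e8 in T2.
set w2 := gauss_factor t ^+ 2 in T2 *; set w := gauss_factor t in T1 *.
set z2 := (_ +i* _) in T2; set z1 := (_ +i* _) in T1; set z0 := (_ +i* _) in T3.
(* The Taylor polynomials of order 2 satisfy the equation exactly. *)
have poly0 : z2 - z1 - a%:C * (z0 - 1) = 0.
  rewrite /z2 /z1 /z0; apply/eqP; rewrite eq_complex /=.
  by apply/andP; split; apply/eqP; rewrite /ascent_variance -?aE; field.
rewrite (_ : w2 - w - _ =
  (w2 - z2) + (- (w - z1) + - (a%:C * (cis t - z0)))); last first.
  apply/eqP; rewrite -subr_eq0 -[X in _ == X]poly0; apply/eqP; ring.
have n1 := ler_normcD (w2 - z2) (- (w - z1) + - (a%:C * (cis t - z0))).
have n2 := ler_normcD (- (w - z1)) (- (a%:C * (cis t - z0))).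
rewrite !normc_opp Normc.normcM normc_real ger0_norm in n2; last lra.
have n3 : a * normc (cis t - z0) <= 1 * (15 * `|t| ^+ 3).
  by apply: ler_pM; rewrite ?normc_ge0//; lra.
by apply: (le_trans n1); lra.
Qed.

(** The eigenvector that [twisted_step] would have if [gauss_factor t] were an
    exact root of its characteristic polynomial, normalised by its value at the
    initial state [true]. *)
Definition quasi_eigenvector t b : R[i] :=
  if b then 1 else (gauss_factor t - P) / Q.

Let QE : Q = q%:C. Proof. by rewrite rmorphB rmorph1. Qed.
Let Q_neq0 : Q != 0.
Proof.
by rewrite QE -(rmorph0 (real_complex R)) (inj_eq (@complexI _)) subr_eq0 gt_eqF.
Qed.
Let normcQ : normc Q = q.
Proof. by rewrite QE normc_real ger0_norm// subr_ge0 ltW. Qed.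

Lemma quasi_eigenvector_defect t b : `|t| <= 4 ->
  normc (twisted_step p (cis t) (quasi_eigenvector t) b -
         gauss_factor t * quasi_eigenvector t b) <= 150 / q * `|t| ^+ 3.
Proof.
move=> t4; have q0 : 0 < q by rewrite subr_gt0.
case: b.
  have -> : twisted_step p (cis t) (quasi_eigenvector t) true -
      gauss_factor t * quasi_eigenvector t true = 0.
    exact: quasi_eigenvector_true.
  rewrite Normc.normc0; apply: mulr_ge0; last exact: exprn_ge0.
  by apply: divr_ge0 => //; exact: ltW.
have -> : twisted_step p (cis t) (quasi_eigenvector t) false -
      gauss_factor t * quasi_eigenvector t false =
    - ((gauss_factor t ^+ 2 - gauss_factor t - (p * q)%:C * (cis t - 1)) / Q).
  by rewrite rmorphM /= -QE; exact: quasi_eigenvector_false.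
rewrite normc_opp Normc.normcM Normc.normcV normcQ mulrAC ler_wpM2r//.
  by rewrite invr_ge0 ltW.
exact: gauss_factor_root.
Qed.

(** Induction on [m]: the defect of a step is damped by the steps that remain
    ([twisted_exp_decay]), and the earlier error by the modulus of
    [gauss_factor t].  Each of the [m] terms carries the full exponential, up to
    the constant due to the shift by one step. *)
Lemma quasi_eigenvector_iter t m b : `|t| <= 4 ->
  normc (twisted_exp p (cis t) (quasi_eigenvector t) m b -
         gauss_factor t ^+ m * quasi_eigenvector t b) <=
  m%:R * (expR (16 * d) ^+ 2 * expR (- (d * t ^+ 2 * m%:R))) *
  (150 / q * `|t| ^+ 3).
Proof.
move=> t4; set A := expR (16 * d); set dl := _ / _ * _.
have d0 := decay_gt0 p_gt0 p_lt1.
elim: m b => [|m IHm] b.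
  by rewrite /twisted_exp /= !mul1r subrr Normc.normc0 !mul0r.
pose W b := twisted_step p (cis t) (quasi_eigenvector t) b -
  gauss_factor t * quasi_eigenvector t b.
rewrite twisted_expSr.
have -> : twisted_exp p (cis t)
    (twisted_step p (cis t) (quasi_eigenvector t)) m b =
    twisted_exp p (cis t) W m b + gauss_factor t *
      twisted_exp p (cis t) (quasi_eigenvector t) m b.
  rewrite -twisted_expZ -twisted_expD /twisted_exp.
  by apply: eq_coin_exp => l _; rewrite /W subrK.
set X := twisted_exp p (cis t) (quasi_eigenvector t) m b in IHm *.
rewrite exprS (_ : _ - _ = twisted_exp p (cis t) W m b + gauss_factor t *
  (X - gauss_factor t ^+ m * quasi_eigenvector t b)); last by ring.
apply: (le_trans (ler_normcD _ _)); rewrite Normc.normcM.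
have W_le : normc (twisted_exp p (cis t) W m b) <=
    A * expR (- (d * t ^+ 2 * m%:R)) * dl.
  apply: twisted_exp_decay => // b'; exact: quasi_eigenvector_defect.
have dl0 : 0 <= dl.
  by rewrite /dl mulr_ge0 ?exprn_ge0// divr_ge0// subr_ge0 ltW.
have A0 : 0 < A by exact: expR_gt0.
have expS : expR (- (d * t ^+ 2 * m.+1%:R)) =
    expR (- (d * t ^+ 2)) * expR (- (d * t ^+ 2 * m%:R)).
  by rewrite -expRD -natr1; congr expR; ring.
have AE : 1 <= A * expR (- (d * t ^+ 2)).
  rewrite -expRD -[leLHS]expR0 ler_expR.
  have : d * t ^+ 2 <= d * 16 by rewrite (ler_wpM2l (ltW d0))// sqr_le16.
  lra.
set e := expR (- (d * t ^+ 2 * m%:R)) in IHm W_le expS *.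
have e0 : 0 < e by exact: expR_gt0.
have g_le := normc_gauss_factor t.
rewrite expS; set g := expR (- (d * t ^+ 2)) in g_le AE *.
have g0 : 0 < g by exact: expR_gt0.
have step1 : normc (gauss_factor t) *
    normc (X - gauss_factor t ^+ m * quasi_eigenvector t b) <=
    g * (m%:R * (A ^+ 2 * e) * dl).
  by apply: ler_pM => //; rewrite ?normc_ge0//; exact: IHm.
have step2 : A * e * dl <= A * e * dl * (A * g).
  by rewrite ler_peMr// mulr_ge0// mulr_ge0 ?ltW.
apply: (le_trans (lerD (le_trans W_le step2) step1)).
by rewrite -natr1 le_eqVlt; apply/orP; left; apply/eqP; ring.
Qed.

(** The error is [O(|t| + m |t|^3)] times [exp(- d m t^2)]; half of the
    exponent is spent on absorbing [m t^2]. *)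
Lemma twisted_exp_gauss (h : R) : 0 <= h -> exists2 C : R, 0 < C &
  forall t m (H : bool -> R[i]), `|t| <= 4 ->
    (forall b, normc (H b - 1) <= h * `|t|) ->
    normc (twisted_exp p (cis t) H m true - gauss_factor t ^+ m) <=
    C * `|t| * expR (- (d / 2 * t ^+ 2 * m%:R)).
Proof.
move=> h0; set A := expR (16 * d).
have q0 : 0 < q by rewrite subr_gt0.
have d0 := decay_gt0 p_gt0 p_lt1.
have A0 : 0 < A by exact: expR_gt0.
exists (A * (h + 4 / q) + A ^+ 2 * (150 / q) * (2 / d)).
  have t1 : 0 < 4 / q by rewrite divr_gt0.
  by rewrite addr_gt0// !mulr_gt0 ?exprn_gt0 ?divr_gt0 ?invr_gt0//; lra.
move=> t m H t4 H1.
set V := quasi_eigenvector t.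
have HV b : normc (H b - V b) <= (h + 4 / q) * `|t|.
  rewrite (_ : H b - V b = (H b - 1) + - (V b - 1)); last by ring.
  apply: (le_trans (ler_normcD _ _)); rewrite normc_opp mulrDl lerD//.
  rewrite /V /quasi_eigenvector; case: b {H1}.
    by rewrite subrr Normc.normc0 mulr_ge0// divr_ge0// ltW.
  have -> : (gauss_factor t - P) / Q - 1 = (gauss_factor t - 1) / Q.
    by rewrite -{2}(divff Q_neq0) -mulrBl opprB addrA subrK.
  rewrite Normc.normcM Normc.normcV normcQ mulrAC ler_wpM2r ?invr_ge0//.
    exact: ltW.
  exact: gauss_factorB1.
have D1 : normc (twisted_exp p (cis t) (fun b => H b - V b) m true) <=
    A * expR (- (d * t ^+ 2 * m%:R)) * ((h + 4 / q) * `|t|).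
  exact: twisted_exp_decay.
have D2 := quasi_eigenvector_iter m true t4.
rewrite -/V -/A {2}/V /quasi_eigenvector mulr1 in D2.
have -> : twisted_exp p (cis t) H m true - gauss_factor t ^+ m =
    twisted_exp p (cis t) (fun b => H b - V b) m true +
    (twisted_exp p (cis t) V m true - gauss_factor t ^+ m).
  rewrite addrA -twisted_expD; congr (_ - _).
  by apply: eq_coin_exp => l _; rewrite subrK.
apply: (le_trans (ler_normcD _ _)); apply: (le_trans (lerD D1 D2)).
set x := d / 2 * t ^+ 2 * m%:R.
have A_ge0 := ltW A0; have d_ge0 := ltW d0.
have hq : 0 <= h + 4 / q by apply: addr_ge0 => //; apply: divr_ge0 => //; exact: ltW.
have q150 : 0 <= 150 / q by apply: divr_ge0 => //; exact: ltW.
have d2 : 0 <= 2 / d by exact: divr_ge0.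
have x0 : 0 <= x.
  have dh : 0 <= d / 2 by apply: divr_ge0.
  by rewrite /x mulr_ge0// mulr_ge0// sqr_ge0.
have -> : d * t ^+ 2 * m%:R = 2 * x by rewrite /x; field.
have t3 : `|t| ^+ 3 = `|t| * t ^+ 2.
  by rewrite exprS real_normK ?num_real.
have mt : m%:R * t ^+ 2 = 2 / d * x.
  by rewrite /x; field; rewrite gt_eqF.
have e2 : expR (- (2 * x)) = expR (- x) * expR (- x) by rewrite -expRD; congr expR; ring.
have e_gt0 : 0 < expR (- x) := expR_gt0 _.
have e_le1 : expR (- x) <= 1 by rewrite -expR0 ler_expR; lra.
(* Half of the exponential absorbs [x], a multiple of [m t^2]. *)
have xe : x * expR (- x) <= 1.
  have : x <= expR x by have he := expR_ge1Dx x; lra.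
  by rewrite expRN ler_pdivrMr ?expR_gt0// mul1r.
have T0 := normr_ge0 t.
have e_ge0 := ltW e_gt0.
rewrite t3 (_ : m%:R * (A ^+ 2 * expR (- (2 * x))) * (150 / q * (`|t| * t ^+ 2))
  = A ^+ 2 * (150 / q) * `|t| * expR (- (2 * x)) * (m%:R * t ^+ 2)); last by ring.
rewrite mt e2.
have k1 : A * (expR (- x) * expR (- x)) * ((h + 4 / q) * `|t|) <=
   A * (h + 4 / q) * `|t| * expR (- x).
  rewrite (_ : A * _ * _ = A * (h + 4 / q) * `|t| * expR (- x) * expR (- x));
    last by ring.
  by rewrite ler_piMr// mulr_ge0// mulr_ge0// mulr_ge0.
have k2 : A ^+ 2 * (150 / q) * `|t| * (expR (- x) * expR (- x)) * (2 / d * x) <=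
   A ^+ 2 * (150 / q) * (2 / d) * `|t| * expR (- x).
  rewrite (_ : A ^+ 2 * _ * _ * _ * _ =
    A ^+ 2 * (150 / q) * (2 / d) * `|t| * expR (- x) * (x * expR (- x)));
    last by ring.
  by rewrite ler_piMr// mulr_ge0// mulr_ge0// mulr_ge0// mulr_ge0// exprn_ge0.
by apply: (le_trans (lerD k1 k2)); rewrite -mulrDl -mulrDl.
Qed.

End QuasiEigenvector.

(** * Characteristic function of the number of wrong guesses *)

Definition misses {R : realType} (p : R) (n : nat) (l : seq bool) : nat :=
  n - score (early_guess p n) 0 0 l.

Section MissesCharacteristic.
Local Open Scope complex_scope.
Variables (R : realType) (p : R).
Local Notation normc := (@Normc.normc R).
Local Notation q := (1 - p).
Local Notation P := (p%:C).

Lemma Re_coin_exp (n : nat) (F : seq bool -> R[i]) :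
  complex.Re (coin_exp P n F) = coin_exp p n (fun l => complex.Re (F l)).
Proof.
elim: n F => [//|n IHn] F /=; rewrite -!IHn -(rmorph1 (real_complex R)) -rmorphB.
case: (coin_exp _ _ _) => a b; case: (coin_exp _ _ _) => c d /=.
by rewrite !mul0r !subr0.
Qed.

Hypotheses (p_gt0 : 0 < p) (p_lt1 : p < 1).

Lemma coin_exp_cisB1_le (k : nat) (t : R) (D : seq bool -> nat) :
  (forall l, (D l <= k)%N) ->
  normc (coin_exp P k (fun l => cis (t * (D l)%:R)) - 1) <= 2 * k%:R * `|t|.
Proof.
move=> Dk.
have bound j : (j <= k)%N -> normc (cis (t * j%:R) - 1) <= 2 * k%:R * `|t|.
  move=> jk; apply: (le_trans (normc_cisB1 _)).
  rewrite normrM normr_nat -mulrA ler_wpM2l// mulrC ler_wpM2r// ler_nat//.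
suff gen (i : nat) (G : seq bool -> R[i]) (x : R) : (forall l, normc (G l - 1) <= x) ->
    normc (coin_exp P i G - 1) <= x by apply: gen => l; exact: bound.
elim: i G => [|i IHi] G Gx /=; first exact: Gx.
set z1 := coin_exp _ _ _; set z2 := coin_exp _ _ _.
rewrite (_ : _ - 1 = P * (z1 - 1) + (1 - P) * (z2 - 1)); last by ring.
apply: (le_trans (normc_weights p_gt0 p_lt1 _ _)).
have h1 : normc (z1 - 1) <= x by apply: IHi.
have h2 : normc (z2 - 1) <= x by apply: IHi.
have k1 : p * normc (z1 - 1) <= p * x by rewrite ler_wpM2l// ltW.
have k2 : q * normc (z2 - 1) <= q * x by rewrite ler_wpM2l// subr_ge0 ltW.
by lra.
Qed.

Lemma normcXB1_le (z : R[i]) (x : R) (k : nat) : normc z <= 1 ->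
  normc (z - 1) <= x -> normc (z ^+ k - 1) <= k%:R * x.
Proof.
move=> z1 zx; elim: k => [|k IHk]; first by rewrite expr0 subrr Normc.normc0 mul0r.
rewrite exprS (_ : _ - 1 = z * (z ^+ k - 1) + (z - 1)); last by ring.
apply: (le_trans (ler_normcD _ _)); rewrite Normc.normcM -natr1 mulrDl mul1r.
apply: lerD => //; apply: le_trans IHk; rewrite ler_piMl// normc_ge0//.
Qed.

(** Condition on all the coins but the last [k]: their contribution is a
    function [H] of the state with [H = 1 + O(t)], so that
    [twisted_exp_gauss] applies, and [gauss_factor t ^+ k] is [1 + O(t)] as
    well. *)
Lemma misses_characteristic : exists C c : R, [/\ 0 < C, 0 < c &
  exists N : nat, forall n : nat, (N <= n)%N -> forall t : R, `|t| <= 4 ->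
  normc (coin_exp P n (fun l => cis (t * (misses p n l)%:R)) -
         gauss_factor p t ^+ n) <= C * `|t| * expR (- (c * t ^+ 2 * n%:R))].
Proof.
have [k k_gt1 split_score] := score_ascents p.
have d0 := decay_gt0 p_gt0 p_lt1; set d := decay p in d0.
have [C0 C0_gt0 gauss] :=
  twisted_exp_gauss p_gt0 p_lt1 (mulr_ge0 (ler0n R 2) (ler0n R k)).
set A := expR (d / 2 * 16 * k%:R); have A0 : 0 < A := expR_gt0 _.
exists ((C0 + 4 * k%:R) * A), (d / 2); split.
- by rewrite mulr_gt0// ltr_wpDr// mulr_ge0.
- by rewrite divr_gt0.
exists k => n kn t t4; have [m nE] : exists m, n = (m + k)%N.
  by exists (n - k)%N; rewrite subnK.
have [D D_le DE] := split_score m.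
pose H b := coin_exp P k (fun l2 => cis (t * (D b l2)%:R)).
have -> : coin_exp P n (fun l => cis (t * (misses p n l)%:R)) =
    twisted_exp p (cis t) H m true.
  rewrite nE coin_exp_cat; apply: eq_coin_exp => l1 sl1.
  rewrite /H -coin_expZ; apply: eq_coin_exp => l2 sl2.
  rewrite -cisMn -cisD -mulrDr -natrD; congr (cis (t * _%:R)).
  by have := DE l1 l2 sl1 sl2; rewrite /misses; lia.
have H1 b : normc (H b - 1) <= 2 * k%:R * `|t|.
  exact: coin_exp_cisB1_le.
have main := gauss t m H t4 H1.
have g_le := normc_gauss_factor p_gt0 p_lt1 t; rewrite -/d in g_le.
have g_le1 : normc (gauss_factor p t) <= 1.
  apply: (le_trans g_le); rewrite -[leRHS]expR0 ler_expR oppr_le0.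
  by rewrite mulr_ge0 ?sqr_ge0// ltW.
have gk := normcXB1_le k g_le1 (gauss_factorB1 p_gt0 p_lt1 t4).
set e := expR (- (d / 2 * t ^+ 2 * m%:R)) in main.
have e_le : e <= A * expR (- (d / 2 * t ^+ 2 * n%:R)).
  rewrite /e /A -expRD ler_expR nE natrD.
  have dk : 0 <= d / 2 * k%:R by rewrite mulr_ge0// divr_ge0// ltW.
  by have := ler_wpM2l dk (sqr_le16 t4); lra.
have gm : normc (gauss_factor p t ^+ m) <= e.
  apply: (@le_trans _ _ (expR (- (d * t ^+ 2)) ^+ m)).
    by rewrite normcX; apply: lerXn2r; rewrite ?nnegrE ?normc_ge0 ?expR_ge0.
  rewrite /e -expRM_natr ler_expR.
  have : 0 <= d * t ^+ 2 * m%:R by rewrite mulr_ge0// mulr_ge0 ?sqr_ge0 ?(ltW d0).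
  by lra.
have -> : twisted_exp p (cis t) H m true - gauss_factor p t ^+ n =
    (twisted_exp p (cis t) H m true - gauss_factor p t ^+ m) +
    (- (gauss_factor p t ^+ m * (gauss_factor p t ^+ k - 1))).
  by rewrite nE exprD; ring.
apply: (le_trans (ler_normcD _ _)); rewrite normc_opp Normc.normcM.
have step : normc (gauss_factor p t ^+ m) * normc (gauss_factor p t ^+ k - 1) <=
    e * (k%:R * (4 * `|t|)).
  by apply: ler_pM; rewrite ?normc_ge0.
apply: (le_trans (lerD main step)).
rewrite (_ : C0 * _ * e + _ = (C0 + 4 * k%:R) * `|t| * e); last by ring.
rewrite (_ : _ * A * _ * _ = (C0 + 4 * k%:R) * `|t| *
  (A * expR (- (d / 2 * t ^+ 2 * n%:R)))); last by ring.
by rewrite ler_wpM2l// mulr_ge0// addr_ge0 ?mulr_ge0// ltW.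
Qed.

(** Real part of [misses_characteristic] after multiplication by
    [cis (- t y)]; real integrals then suffice for the inversion. *)
Lemma cos_misses_gauss : exists C c : R, [/\ 0 < C, 0 < c &
  exists N : nat, forall n : nat, (N <= n)%N -> forall t y : R, `|t| <= 4 ->
  `| coin_exp p n (fun l => cos (t * ((misses p n l)%:R - y))) -
     expR (- (ascent_variance p * n%:R * t ^+ 2 / 2)) *
       cos ((p * q * n%:R - y) * t) | <=
  C * `|t| * expR (- (c * t ^+ 2 * n%:R))].
Proof.
have [C [c [C0 c0 [N char]]]] := misses_characteristic.
exists C, c; split => //; exists N => n Nn t y t4.
apply: le_trans (char n Nn t t4).
have rot z : normc z = normc (z * cis (- (t * y))).
  by rewrite Normc.normcM normc_cis mulr1.
rewrite rot; apply: le_trans (Re_le_normc _).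
rewrite le_eqVlt; apply/orP; left; apply/eqP; congr `|_|.
set g := gauss_factor p t ^+ n; set z := coin_exp P n _.
rewrite (_ : (z - g) * _ = z * cis (- (t * y)) - g * cis (- (t * y))); last by ring.
rewrite {}/g {}/z.
have -> : coin_exp P n (fun l => cis (t * (misses p n l)%:R)) * cis (- (t * y))
    = coin_exp P n (fun l => cis (t * ((misses p n l)%:R - y))).
  rewrite mulrC -coin_expZ; apply: eq_coin_exp => l _.
  by rewrite -cisD; congr cis; ring.
have -> : gauss_factor p t ^+ n * cis (- (t * y)) =
    (expR (- (ascent_variance p * n%:R * t ^+ 2 / 2)))%:C *
    cis ((p * q * n%:R - y) * t).
  rewrite /gauss_factor exprMn -rmorphXn -expRM_natr -cisMn -[LHS]mulrA -cisD.
  by congr ((expR _)%:C * cis _); field.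
set z := coin_exp P n _.
have -> : coin_exp p n (fun l => cos (t * ((misses p n l)%:R - y))) = complex.Re z.
  by rewrite Re_coin_exp.
by case: z => a b /=; rewrite mul0r subr0.
Qed.

End MissesCharacteristic.

(** * Integrals of continuous functions and the Gaussian tail *)

Section ContinuousIntegrals.
Local Open Scope classical_set_scope.
Local Open Scope ring_scope.
Variable R : realType.
Local Notation mu := (@lebesgue_measure R).
Implicit Types (f g F : R -> R) (a b x : R).

Lemma continuous_integrable f a b : continuous f ->
  mu.-integrable `[a, b] (EFin \o f).
Proof.
move=> cf; apply: continuous_compact_integrable; first exact: segment_compact.
exact: continuous_subspaceT.
Qed.

Lemma is_derive_continuous F f :
  (forall x, is_derive x 1 F (f x)) -> continuous F.
Proof.
move=> Ff x; apply/differentiable_continuous/derivable1_diffP.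
by have := Ff x; case.
Qed.

(** The fundamental theorem of calculus for a primitive defined on the whole
    line. *)
Lemma Rintegral_derivative F f a b : a < b ->
  (forall x, is_derive x 1 F (f x)) -> continuous f ->
  \int[mu]_(x in `[a, b]) f x = F b - F a.
Proof.
move=> ab Ff cf; have cF := is_derive_continuous Ff.
rewrite /Rintegral (@continuous_FTC2 R f F a b ab) //.
- exact: continuous_subspaceT.
- split => [x _||]; first by have := Ff x; case.
    by apply: cvg_at_right_filter; exact: cF.
  by apply: cvg_at_left_filter; exact: cF.
- by move=> x _; rewrite derive1E; have := Ff x; case.
Qed.

Lemma le_RintegralT f g a b : continuous f -> continuous g ->
  (forall x, x \in `[a, b] -> f x <= g x) ->
  \int[mu]_(x in `[a, b]) f x <= \int[mu]_(x in `[a, b]) g x.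
Proof.
by move=> cf cg fg; apply: le_Rintegral => //; exact: continuous_integrable.
Qed.

Lemma normr_RintegralB_le f g k a b : continuous f -> continuous g ->
  continuous k -> (forall x, x \in `[a, b] -> `|f x - g x| <= k x) ->
  `|\int[mu]_(x in `[a, b]) f x - \int[mu]_(x in `[a, b]) g x| <=
  \int[mu]_(x in `[a, b]) k x.
Proof.
move=> cf cg ck fgk.
rewrite -RintegralB//; try exact: continuous_integrable.
have cfg : continuous (fun x => f x - g x).
  by move=> x; apply: cvgB; [exact: cf|exact: cg].
apply: (le_trans (le_normr_Rintegral _ _)) => //.
  exact: (@continuous_integrable (fun x => f x - g x) a b cfg).
apply: le_RintegralT => // x.
apply: (@continuous_comp _ _ _ (fun x => f x - g x) (fun y => `|y|)).
  exact: cfg.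
exact: norm_continuous.
Qed.

Lemma Rintegral_mul_expR (c : R) : 0 < c ->
  \int[mu]_(t in `[0, pi]) (t * expR (- (c * t ^+ 2))) <= (2 * c)^-1.
Proof.
move=> c0.
have dF (t : R) : is_derive t 1 (fun t : R => - (2 * c)^-1 * expR (- (c * t ^+ 2)))
    (t * expR (- (c * t ^+ 2))).
  by apply: is_derive_eq; rewrite /GRing.scale /=; field; rewrite gt_eqF.
rewrite (Rintegral_derivative (pi_gt0 R) dF).
  rewrite expr0n /= mulr0 oppr0 expR0 mulr1 opprK addrC gerDl.
  by rewrite mulNr oppr_le0 mulr_ge0 ?expR_ge0// invr_ge0 mulr_ge0// ltW.
move=> t; apply: cvgM => //.
have dE : forall t : R, is_derive t 1 (fun t : R => expR (- (c * t ^+ 2)))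
    (- (2 * c * t) * expR (- (c * t ^+ 2))).
  by move=> s; apply: is_derive_eq; rewrite /GRing.scale /=; ring.
exact: (is_derive_continuous dE).
Qed.

Lemma Rintegral_cos_int (j : int) :
  \int[mu]_(t in `[0, pi]) cos (t * j%:~R) = if j == 0 then pi else 0.
Proof.
case: eqVneq => [->|j0].
  under eq_Rintegral do rewrite mulr0 cos0.
  rewrite Rintegral_cst// mul1r /= lebesgue_measure_itv /= lte_fin pi_gt0 /=.
  by rewrite subr0.
have jR : j%:~R != 0 :> R by rewrite intr_eq0.
have dF (t : R) : is_derive t 1 (fun t : R => (j%:~R)^-1 * sin (t * j%:~R))
    (cos (t * j%:~R)).
  by apply: is_derive_eq; rewrite /GRing.scale /=; field.
rewrite (Rintegral_derivative (pi_gt0 R) dF).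
  rewrite mul0r sin0 mulr0 subr0.
  have sin_nat (n : nat) : sin (pi * n%:R) = 0 :> R.
    have := alternatingn (@sinDpi R) n 0.
    by rewrite add0r sin0 mulr0 mulr_natr.
  case: (intP j) => [|n|n]; first by rewrite mulr0 sin0 mulr0.
    by rewrite sin_nat mulr0.
  by rewrite mulrN sinN sin_nat oppr0 mulr0.
move=> t; apply: continuous_comp; last exact: continuous_cos.
by apply: cvgM => //; exact: cvg_cst.
Qed.

End ContinuousIntegrals.

Section GaussIntegral.
Local Open Scope classical_set_scope.
Local Open Scope ring_scope.
Variable R : realType.
Local Notation mu := (@lebesgue_measure R).

(** The tail of the Gaussian integral is at most the integral of
    [2 t exp(- t^2)], which has an explicit primitive. *)
Lemma gauss_tail (x : R) : 1 <= x ->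
  `|\int[mu]_(t in `[0, x]) gauss_fun t - Num.sqrt pi / 2| <= expR (- x ^+ 2).
Proof.
move=> x1.
have x0 : 0 <= x by lra.
have mg (A : set R) : measurable_fun A (EFin \o @gauss_fun R).
  by apply/measurable_EFinP/measurable_funTS; exact: measurable_gauss_fun.
have g0 (t : R) : (0 <= (gauss_fun t)%:E)%E by rewrite lee_fin gauss_fun_ge0.
have tail : (\int[mu]_(t in `]x, +oo[) (gauss_fun t)%:E <= (expR (- x ^+ 2))%:E)%E.
  have dF (t : R) : is_derive t 1 (fun t : R => - expR (- t ^+ 2))
      (2 * t * expR (- t ^+ 2)).
    by apply: is_derive_eq; rewrite /GRing.scale /=; ring.
  have cF := is_derive_continuous dF.
  have cf : continuous (fun t : R => 2 * t * expR (- t ^+ 2)).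
    move=> t; apply: cvgM; first by apply: cvgM => //; exact: cvg_cst.
    exact: continuous_gauss_fun.
  have := @ge0_continuous_FTC2y R (fun t => 2 * t * expR (- t ^+ 2))
    (fun t => - expR (- t ^+ 2)) x 0.
  move=> FTC; apply: (@le_trans _ _
    (\int[mu]_(t in `[x, +oo[) (2 * t * expR (- t ^+ 2))%:E)%E); last first.
    rewrite FTC.
    - by rewrite -EFinB sub0r opprK.
    - by move=> t xt; rewrite mulr_ge0 ?expR_ge0//; lra.
    - exact: continuous_subspaceT.
    - by rewrite -[X in _ --> X]oppr0; apply: cvgN; exact: cvg_gauss_fun.
    - by move=> t _; have := dF t; case.
    - by apply: cvg_at_right_filter; exact: cF.
    - by move=> t _; rewrite derive1E; have := dF t; case.
  rewrite integral_itv_obnd_cbnd//.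
  apply: ge0_le_integral => //; first exact: mg.
  - by apply/measurable_EFinP/measurable_funTS; exact: continuous_measurable_fun.
  move=> t; rewrite /= in_itv /= andbT => xt.
  by rewrite lee_fin /gauss_fun ler_peMl ?expR_ge0//; lra.
have split_int : (\int[mu]_(t in `[0%R : R, +oo[) (gauss_fun t)%:E =
    \int[mu]_(t in `[0%R, x]) (gauss_fun t)%:E +
    \int[mu]_(t in `]x, +oo[) (gauss_fun t)%:E)%E.
  rewrite -ge0_integral_setU//=.
    by rewrite -itv_bndbnd_setU// bnd_simp.
  - exact: mg.
  apply/disj_setPS => y [/=]; rewrite 2!in_itv/= => /andP[_ yx].
  by rewrite andbT ltNge yx.
rewrite integral0y_gauss in split_int.
have fin0 : (\int[mu]_(t in `[0%R, x]) (gauss_fun t)%:E)%E \is a fin_num.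
  apply: integrable_fin_num => //.
  by apply: continuous_integrable; exact: continuous_gauss_fun.
have T0 : (0 <= \int[mu]_(t in `]x, +oo[) (gauss_fun t)%:E)%E.
  by apply: integral_ge0.
move: split_int tail T0; rewrite -(fineK fin0) -/(Rintegral _ _ _).
case: (\int[mu]_(t in `]x, +oo[) _)%E => // T.
rewrite -EFinD !lee_fin => -[->] h1 h2.
by rewrite opprD addrA subrr sub0r normrN ger0_norm.
Qed.

End GaussIntegral.

(** * Cosine transform of a truncated Gaussian *)

Section GaussCosine.
Local Open Scope classical_set_scope.
Local Open Scope ring_scope.
Variable R : realType.
Local Notation mu := (@lebesgue_measure R).
Variable s : R.

Let E (t : R) : R := expR (- (s * t ^+ 2 / 2)).

Definition gauss_cosine (a : R) : R :=
  \int[mu]_(t in `[0, pi]) (E t * cos (a * t)).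

Let S (a : R) : R := \int[mu]_(t in `[0, pi]) (t * E t * sin (a * t)).

Let dE (t : R) : is_derive t 1 E (- (s * t * E t)).
Proof. by apply: is_derive_eq; rewrite /GRing.scale /= /E; field. Qed.

Let cE : continuous E.
Proof. exact: is_derive_continuous dE. Qed.

Let cM (a : R) : continuous (fun t : R => a * t).
Proof. by move=> t; apply: cvgM => //; exact: cvg_cst. Qed.

Let ccos (a : R) : continuous (fun t : R => cos (a * t)).
Proof.
move=> t; apply: (@continuous_comp _ _ _ (fun t => a * t) cos); first exact: cM.
exact: continuous_cos.
Qed.

Let csin (a : R) : continuous (fun t : R => sin (a * t)).
Proof.
move=> t; apply: (@continuous_comp _ _ _ (fun t => a * t) sin); first exact: cM.
exact: continuous_sin.
Qed.

Let cG (a : R) : continuous (fun t : R => E t * cos (a * t)).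
Proof. by move=> t; apply: cvgM; [exact: cE | exact: ccos]. Qed.

Let ctE : continuous (fun t : R => t * E t).
Proof. by move=> t; apply: cvgM => //; exact: cE. Qed.

Let cS (a : R) : continuous (fun t : R => t * E t * sin (a * t)).
Proof. by move=> t; apply: cvgM; [exact: ctE | exact: csin]. Qed.

Let dcos (t a : R) : is_derive a 1 (fun a : R => E t * cos (a * t))
   (- (t * E t * sin (a * t))).
Proof. by apply: is_derive_eq; rewrite /GRing.scale /=; ring. Qed.

Let int_opp (f : R -> R) : continuous f ->
  \int[mu]_(t in `[0, pi]) (- f t) = - \int[mu]_(t in `[0, pi]) f t.
Proof.
move=> cf; rewrite -[RHS]mulN1r -RintegralZl//; last exact: continuous_integrable.
by apply: eq_Rintegral => t _; rewrite mulN1r.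
Qed.

(** Differentiation under the integral sign, the derivative being dominated by
    [|t E t|]. *)
Lemma derive_gauss_cosine (a : R) : is_derive a 1 gauss_cosine (- S a).
Proof.
pose f (a t : R) := E t * cos (a * t).
pose g (t : R) := `|t * E t|.
have cg : continuous (fun t : R => `|t * E t|).
  move=> t; apply: (@continuous_comp _ _ _ (fun t : R => t * E t) (fun y : R => `|y|)).
    exact: ctE.
  exact: norm_continuous.
have d1 (x t : R) : partial1of2 f x t = - (t * E t * sin (x * t)).
  by rewrite partial1of2E; have := dcos t x; case.
have Ia : `]a - 1, a + 1[%classic a by rewrite /= in_itv /=; lra.
have intf (x : R) : `]a - 1, a + 1[%classic x -> mu.-integrable `[0, pi] (EFin \o f x).
  by move=> _; exact: (@continuous_integrable _ (f x) 0 pi (@cG x)).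
have derf (x t : R) : `]a - 1, a + 1[%classic x -> `[0, pi]%classic t ->
    derivable (f ^~ t) x 1.
  by move=> _ _; have [h _] := dcos t x; exact: h.
have g_ge0 (t : R) : 0 <= g t by exact: normr_ge0.
have intg : mu.-integrable `[0, pi] (EFin \o g).
  exact: (@continuous_integrable _ g 0 pi cg).
have g_ub (x t : R) : `]a - 1, a + 1[%classic x -> `[0, pi]%classic t ->
    `|partial1of2 f x t| <= g t.
  by move=> _ _; rewrite d1 normrN normrM ler_piMr// sin_max.
have mI := @measurable_itv R `[0, pi].
apply: DeriveDef.
  exact: (@derivable_under_integral _ _ _ mu f _ mI a _ _ Ia intf derf g g_ge0 intg g_ub).
rewrite -derive1E (@differentiation_under_integral _ _ _ mu f _ mI a _ _ Ia intf
  derf g g_ge0 intg g_ub).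
by under eq_Rintegral do rewrite d1; exact: int_opp.
Qed.

Hypothesis s_gt0 : 0 < s.

Let E_le1 (t : R) : E t <= 1.
Proof.
by rewrite /E -expR0 ler_expR oppr_le0 divr_ge0// mulr_ge0 ?sqr_ge0// ltW.
Qed.

(** Integrate the derivative of [E t * sin (a t)].  Together with
    [derive_gauss_cosine] this is the equation [G' = - (a / s) G] of the
    Gaussian, up to the boundary term at [pi]. *)
Lemma gauss_cosine_ode (a : R) : s * S a = a * gauss_cosine a - E pi * sin (a * pi).
Proof.
have dF (t : R) : is_derive t 1 (fun t : R => E t * sin (a * t))
    (a * (E t * cos (a * t)) + - s * (t * E t * sin (a * t))).
  by apply: is_derive_eq; rewrite /GRing.scale /= /E; field.
have i1 : mu.-integrable `[0, pi] (EFin \o (fun t : R => a * (E t * cos (a * t)))).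
  apply: continuous_integrable => t; apply: cvgM; first exact: cvg_cst.
  exact: cG.
have i2 : mu.-integrable `[0, pi]
    (EFin \o (fun t : R => - s * (t * E t * sin (a * t)))).
  apply: continuous_integrable => t; apply: cvgM; first exact: cvg_cst.
  exact: cS.
have := Rintegral_derivative (pi_gt0 R) dF.
rewrite mulr0 sin0 mulr0 subr0 RintegralD// RintegralZl//; last first.
  exact: (@continuous_integrable _ (fun t : R => E t * cos (a * t)) 0 pi (@cG a)).
rewrite RintegralZl//; last first.
  exact: (@continuous_integrable _ (fun t : R => t * E t * sin (a * t)) 0 pi (@cS a)).
rewrite -/(gauss_cosine a) -/(S a) => <-; first by ring.
move=> t; apply: cvgD; first by apply: cvgM; [exact: cvg_cst | exact: cG].
by apply: cvgM; [exact: cvg_cst | exact: cS].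
Qed.

Lemma norm_sine_integral (a : R) : `|S a| <= s^-1.
Proof.
have S0 : \int[mu]_(t in `[0, pi]) (0 : R) = 0 by rewrite Rintegral_cst// mul0r.
have := @normr_RintegralB_le R (fun t => t * E t * sin (a * t)) (fun=> 0)
  (fun t => t * expR (- (s / 2 * t ^+ 2))) 0 pi.
rewrite S0 subr0 -/(S a).
have EE (t : R) : expR (- (s / 2 * t ^+ 2)) = E t by congr expR; field.
move=> H; have s2 : 0 < s / 2 by rewrite divr_gt0.
apply: (@le_trans _ _ (2 * (s / 2))^-1); last by rewrite mulrC divfK.
apply: le_trans (Rintegral_mul_expR s2); apply: H.
- exact: cS.
- exact: cst_continuous.
- by under eq_fun do rewrite EE; exact: ctE.
move=> t; rewrite in_itv /= => /andP[t0 _].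
rewrite subr0 normrM EE ger0_norm; last by rewrite mulr_ge0// expR_ge0.
by rewrite ler_piMr ?sin_max// mulr_ge0// expR_ge0.
Qed.

(** For large frequencies the equation itself bounds the transform, since its
    derivative is at most [1 / s] in absolute value ([norm_sine_integral]). *)
Lemma gauss_cosine_ge (a : R) : s <= `|a| -> `|gauss_cosine a| <= 2 / s.
Proof.
move=> sa; have a0 : 0 < `|a| by exact: lt_le_trans sa.
rewrite -(ler_pM2l a0) -normrM.
have -> : a * gauss_cosine a = s * S a + E pi * sin (a * pi).
  by rewrite gauss_cosine_ode subrK.
apply: (le_trans (ler_normD _ _)); rewrite !normrM (gtr0_norm s_gt0).
have h1 : s * `|S a| <= 1.
  have := norm_sine_integral a; rewrite -(ler_pM2l s_gt0) mulfV// gt_eqF//.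
have h2 : `|E pi| * `|sin (a * pi)| <= 1 * 1.
  apply: ler_pM => //; last exact: sin_max.
  by rewrite ger0_norm ?E_le1// expR_ge0.
apply: (@le_trans _ _ 2); first lra.
rewrite mulrA ler_pdivlMr//; lra.
Qed.

Lemma gauss_cosineN (a : R) : gauss_cosine (- a) = gauss_cosine a.
Proof. by apply: eq_Rintegral => t _; rewrite mulNr cosN. Qed.

Let T (a : R) : R := expR (a ^+ 2 / (2 * s)).

(** Variation of constants: the derivative of
    [G a * exp(a^2 / (2 s))] consists of the boundary term only. *)
Lemma gauss_cosine_profile (a : R) : 0 <= a ->
  `|gauss_cosine a - gauss_cosine 0 * expR (- (a ^+ 2 / (2 * s)))| <=
  a / s * E pi.
Proof.
move=> a0; have sn : s != 0 by rewrite gt_eqF.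
have dG := derive_gauss_cosine.
have dT (x : R) : is_derive x 1 T (x / s * T x).
  by apply: is_derive_eq; rewrite /GRing.scale /= /T; field.
have dH (x : R) : is_derive x 1 (fun x : R => gauss_cosine x * T x)
    (s^-1 * E pi * sin (x * pi) * T x).
  have SE : S x = s^-1 * (x * gauss_cosine x - E pi * sin (x * pi)).
    by rewrite -gauss_cosine_ode mulKf.
  apply: is_derive_eq; rewrite /GRing.scale /= SE; ring.
have cH := @is_derive_within R _ _ 0 a dH.
have [c|c] := MVT_segment a0 (fun x _ => dH x); first exact: cH.
rewrite in_itv /= => /andP[c0 ca].
have T0 : T 0 = 1 by rewrite /T expr0n /= mul0r expR0.
rewrite T0 mulr1 subr0 => HE.
have TE : T a * expR (- (a ^+ 2 / (2 * s))) = 1.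
  by rewrite /T -expRD subrr expR0.
have -> : gauss_cosine a - gauss_cosine 0 * expR (- (a ^+ 2 / (2 * s))) =
    (s^-1 * E pi * sin (c * pi) * T c * a) * expR (- (a ^+ 2 / (2 * s))).
  by rewrite -HE mulrBl -(mulrA _ (T a)) TE mulr1.
have Ta : T c <= T a.
  rewrite /T ler_expR ler_wpM2r// ?invr_ge0 ?mulr_ge0// ?(ltW s_gt0)//.
  by rewrite ler_pXn2r ?nnegrE.
have e0 : 0 <= expR (- (a ^+ 2 / (2 * s))) := expR_ge0 _.
have Ep : 0 <= E pi := expR_ge0 _.
have si : 0 <= s^-1 by rewrite invr_ge0 ltW.
have Tc0 : 0 <= T c := expR_ge0 _.
rewrite !normrM (ger0_norm a0) (ger0_norm e0) (ger0_norm Ep) (ger0_norm si).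
rewrite (ger0_norm Tc0).
have sE : 0 <= s^-1 * E pi by rewrite mulr_ge0.
apply: (@le_trans _ _ (s^-1 * E pi * 1 * T a * a * expR (- (a ^+ 2 / (2 * s))))).
  rewrite ler_wpM2r// ler_wpM2r//; apply: ler_pM => //.
    by rewrite mulr_ge0.
  by rewrite ler_wpM2l// sin_max.
have -> : s^-1 * E pi * 1 * T a * a * expR (- (a ^+ 2 / (2 * s))) =
    a / s * E pi * (T a * expR (- (a ^+ 2 / (2 * s)))) by ring.
by rewrite TE mulr1.
Qed.

(** After the substitution [b t] with [b^2 = s / 2] this is the full Gaussian
    integral up to its tail. *)
Lemma gauss_cosine0 : 1 <= s ->
  `|gauss_cosine 0 - Num.sqrt (2 * pi) / (2 * Num.sqrt s)| <= 2 / s.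
Proof.
move=> s1; pose b := Num.sqrt (s / 2).
have b2 : b ^+ 2 = s / 2 by rewrite sqr_sqrtr// divr_ge0// ltW.
have b0 : 0 < b by rewrite sqrtr_gt0 divr_gt0.
have bhalf : 1 / 2 <= b.
  rewrite leNgt; apply/negP => blt.
  have : b * b < 1 / 2 * (1 / 2) by apply: ltr_pM => //; exact: ltW.
  by rewrite -expr2 b2; lra.
have pi2 := pi_ge2 R.
have bpi : 1 <= b * pi.
  have : 1 / 2 * 2 <= b * pi by apply: ler_pM.
  by lra.
have subst : \int[mu]_(t in `[0, pi]) (E t * b) =
    \int[mu]_(t in `[0, b * pi]) gauss_fun t.
  have der : derive1 (fun t : R => b * t) = cst b.
    apply/funext => z; rewrite derive1E.
    have db : is_derive z 1 (fun t : R => b * t) b.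
      by apply: is_derive_eq; rewrite /GRing.scale /= mulr1.
    by have [_ ->] := db.
  have := @integration_by_substitution_increasing R
    (fun t : R => b * t) (@gauss_fun R) 0 pi
    (pi_ge0 R).
  rewrite der mulr0 => sub; rewrite /Rintegral sub.
  - congr fine; apply: eq_integral => t _; congr ((_ * _)%:E).
    by rewrite /gauss_fun /E /= exprMn b2; congr (expR (- _)); field.
  - by move=> x y _ _ xy; rewrite ltr_pM2l.
  - by move=> x _; exact: cst_continuous.
  - exact: is_cvg_cst.
  - exact: is_cvg_cst.
  - split => [x _||].
    + exact: derivableM.
    + by apply: cvg_at_right_filter; exact: cM.
    + by apply: cvg_at_left_filter; exact: cM.
  - by apply: continuous_subspaceT; exact: continuous_gauss_fun.
have GE : gauss_cosine 0 * b = \int[mu]_(t in `[0, b * pi]) gauss_fun t.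
  rewrite -subst RintegralZr//; last exact: (@continuous_integrable _ E 0 pi cE).
  congr (_ * b); apply: eq_Rintegral => t _.
  by rewrite mul0r cos0 mulr1.
have sqrtE : Num.sqrt (2 * pi) / (2 * Num.sqrt s) = Num.sqrt pi / 2 / b.
  rewrite /b !sqrtrM// ?(ltW s_gt0)// sqrtrV//.
  have q2 : Num.sqrt 2 != 0 :> R by rewrite gt_eqF// sqrtr_gt0.
  have qs : Num.sqrt s != 0 by rewrite gt_eqF// sqrtr_gt0.
  by field; rewrite q2 qs.
have tail := gauss_tail bpi; rewrite -GE in tail.
have bn : b != 0 by rewrite gt_eqF.
rewrite sqrtE (_ : _ - _ = (gauss_cosine 0 * b - Num.sqrt pi / 2) / b); last by field.
rewrite normrM (ger0_norm (_ : 0 <= b^-1)) ?invr_ge0 ?(ltW b0)//.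
have bi : b^-1 <= 2 by rewrite -[leRHS]invrK lef_pV2 ?posrE ?invr_gt0//; lra.
have ex : expR (- (b * pi) ^+ 2) <= s^-1.
  rewrite expRN lef_pV2 ?posrE ?expR_gt0//.
  apply: (@le_trans _ _ ((b * pi) ^+ 2)).
    rewrite exprMn b2; have : s / 2 * 2 <= s / 2 * pi ^+ 2.
      by rewrite ler_wpM2l ?divr_ge0 ?(ltW s_gt0)//; nra.
    by rewrite divfK.
  by have := expR_ge1Dx ((b * pi) ^+ 2); lra.
rewrite mulrC; apply: ler_pM => //; first by rewrite invr_ge0 ltW.
exact: le_trans tail ex.
Qed.

End GaussCosine.

(** * Gaussian estimates *)

Section RealLemmas.
Local Open Scope classical_set_scope.
Local Open Scope ring_scope.
Variable R : realType.
Implicit Types x y z u w s a : R.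

Lemma expRN_le_inv x : 0 < x -> expR (- x) <= x^-1.
Proof.
move=> x0; rewrite expRN lef_pV2 ?posrE ?expR_gt0//.
by have := expR_ge1Dx x; lra.
Qed.

Lemma expRN_lipschitz u w : 0 <= u -> 0 <= w ->
  `|expR (- u) - expR (- w)| <= `|u - w| * expR (- Num.min u w).
Proof.
wlog uw : u w / u <= w.
  move=> wl u0 w0; case/orP: (le_total u w) => [uw|wu]; first exact: wl.
  by rewrite distrC (distrC u) minC; exact: wl.
move=> u0 w0; rewrite (min_l uw) distrC (distrC u).
have ewu : expR (- w) = expR (- (w - u)) * expR (- u).
  by rewrite -expRD; congr expR; ring.
rewrite ewu -[X in _ * _ - X]mul1r -mulrBl normrM (ger0_norm (expR_ge0 _)).
rewrite ler_wpM2r ?expR_ge0//.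
have e1 : expR (- (w - u)) <= 1 by rewrite -expR0 ler_expR; lra.
have e2 := expR_ge1Dx (- (w - u)).
by rewrite ler0_norm ?ger0_norm; lra.
Qed.

Lemma gauss_lipschitz x y :
  `|expR (- (x ^+ 2 / 2)) - expR (- (y ^+ 2 / 2))| <= `|x - y|.
Proof.
wlog xy : x y / x <= y.
  move=> wl; have [xy|/ltW yx] := leP x y; first exact: wl.
  by rewrite distrC (distrC x); exact: wl.
have dF (t : R) : is_derive t 1 (fun t : R => expR (- (t ^+ 2 / 2)))
    (- t * expR (- (t ^+ 2 / 2))).
  by apply: is_derive_eq; rewrite /GRing.scale /=; field.
have cF := @is_derive_within R _ _ x y dF.
have [c|c _] := MVT_segment xy (fun t _ => dF t); first exact: cF.
rewrite distrC (distrC x) => ->; rewrite normrM ler_piMl//.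
have c0 := normr_ge0 c.
rewrite normrM normrN (ger0_norm (expR_ge0 _)) expRN ler_pdivrMr ?expR_gt0//.
rewrite mul1r; apply: le_trans (expR_ge1Dx _).
rewrite -(real_normK (num_real c)).
by have := sqr_ge0 (`|c| - 1); lra.
Qed.

(** The exponents differ by [x^2 / 2 * (r^2 - 1)], and the factor [x^2] is
    absorbed by the exponential as both exponents are at least [x^2 / 4]. *)
Lemma gauss_scale x r : 1 / 2 <= r ^+ 2 ->
  `|expR (- ((x * r) ^+ 2 / 2)) - expR (- (x ^+ 2 / 2))| <= 2 * `|r ^+ 2 - 1|.
Proof.
move=> r2; have x2 := sqr_ge0 x.
have u0 : 0 <= (x * r) ^+ 2 / 2 by rewrite divr_ge0 ?sqr_ge0.
have w0 : 0 <= x ^+ 2 / 2 by rewrite divr_ge0.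
apply: (le_trans (expRN_lipschitz u0 w0)).
have -> : (x * r) ^+ 2 / 2 - x ^+ 2 / 2 = x ^+ 2 / 2 * (r ^+ 2 - 1).
  by rewrite exprMn; field.
rewrite normrM (ger0_norm w0) mulrAC ler_wpM2r//.
have min_ge : x ^+ 2 / 4 <= Num.min ((x * r) ^+ 2 / 2) (x ^+ 2 / 2).
  rewrite le_min; apply/andP; split; last lra.
  rewrite exprMn; have := ler_wpM2l x2 r2; lra.
have e1 : expR (- Num.min ((x * r) ^+ 2 / 2) (x ^+ 2 / 2)) <= expR (- (x ^+ 2 / 4)).
  by rewrite ler_expR lerN2.
have e2 : x ^+ 2 / 4 * expR (- (x ^+ 2 / 4)) <= 1.
  rewrite expRN ler_pdivrMr ?expR_gt0// mul1r.
  by have := expR_ge1Dx (x ^+ 2 / 4); lra.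
have e3 := ler_wpM2l w0 e1; lra.
Qed.

Lemma sqrt_2pi_bounds : 1 <= Num.sqrt (2 * pi : R) <= 3.
Proof.
have p2 := pi_ge2 R; have p4 : pi <= 4 :> R.
  by have := pihalf_lt2 R; lra.
apply/andP; split; first by rewrite -[leLHS]sqrtr1 ler_wsqrtr//; lra.
rewrite -(ger0_norm (_ : 0 <= 3 :> R))// -sqrtr_sqr ler_wsqrtr// expr2; lra.
Qed.

(** The profile estimate is good for [a < s], where its error is at most
    [E pi]; for [a >= s] both terms are small. *)
Lemma gauss_cosine_gauss s a : 1 <= s ->
  `|gauss_cosine s a - Num.sqrt (2 * pi) / (2 * Num.sqrt s) *
     expR (- (a ^+ 2 / (2 * s)))| <= 5 / s.
Proof.
move=> s1; have s0 : 0 < s by lra.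
have si : 0 <= s^-1 by rewrite invr_ge0 ltW.
have /andP[q1 q3] := sqrt_2pi_bounds.
have sq1 : 1 <= Num.sqrt s by rewrite -sqrtr1 ler_wsqrtr.
have pi2 := pi_ge2 R.
set K := Num.sqrt (2 * pi) / (2 * Num.sqrt s).
have K0 : 0 <= K by rewrite divr_ge0// ?mulr_ge0//; lra.
have K32 : K <= 3 / 2.
  rewrite /K ler_pdivrMr; first nra.
  by rewrite mulr_gt0//; lra.
wlog a0 : a / 0 <= a.
  move=> wl; have [|/ltW a0] := leP 0 a; first exact: wl.
  by have := wl (- a); rewrite gauss_cosineN sqrrN; apply; lra.
have e0 := expR_ge0 (- (a ^+ 2 / (2 * s))).
have [sa|sa] := leP s a.
  have g2 : `|gauss_cosine s a| <= 2 / s.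
    by apply: gauss_cosine_ge => //; rewrite ger0_norm.
  apply: (le_trans (ler_normB _ _)).
  rewrite (ger0_norm (mulr_ge0 K0 e0)).
  have e1 : expR (- (a ^+ 2 / (2 * s))) <= 2 / s.
    apply: (@le_trans _ _ (expR (- (s / 2)))).
      rewrite ler_expR lerN2 ler_pdivlMr; last by rewrite mulr_gt0.
      have : s * s <= a * a by apply: ler_pM => //; exact: ltW.
      by rewrite expr2; lra.
    apply: (le_trans (expRN_le_inv _)); first by rewrite divr_gt0.
    by rewrite invf_div.
  have : K * expR (- (a ^+ 2 / (2 * s))) <= 3 / 2 * (2 / s) by apply: ler_pM.
  lra.
rewrite (_ : _ - _ =
  (gauss_cosine s a - gauss_cosine s 0 * expR (- (a ^+ 2 / (2 * s)))) +
  (gauss_cosine s 0 - K) * expR (- (a ^+ 2 / (2 * s)))); last by ring.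
apply: (le_trans (ler_normD _ _)); rewrite normrM (ger0_norm e0).
have h1 := gauss_cosine_profile s0 a0.
have h2 := gauss_cosine0 s0 s1; rewrite -/K in h2.
have h3 : `|gauss_cosine s 0 - K| * expR (- (a ^+ 2 / (2 * s))) <= 2 / s * 1.
  apply: ler_pM => //; rewrite -expR0 ler_expR oppr_le0.
  by rewrite divr_ge0 ?sqr_ge0// mulr_ge0// ltW.
have h4 : expR (- (s * pi ^+ 2 / 2)) <= s^-1.
  have sp : s <= s * pi ^+ 2 / 2.
    have : s * 2 <= s * pi ^+ 2 by rewrite ler_wpM2l ?(ltW s0)//; nra.
    lra.
  apply: (@le_trans _ _ (expR (- s))); first by rewrite ler_expR lerN2.
  exact: expRN_le_inv.
have h5 : a / s * expR (- (s * pi ^+ 2 / 2)) <= 1 * s^-1.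
  apply: ler_pM; rewrite ?expR_ge0//; first by rewrite divr_ge0// ltW.
  by rewrite ler_pdivrMr// mul1r ltW.
lra.
Qed.

End RealLemmas.

(** * Local limit theorem in terms of asymptotic moments *)

Section Inversion.
Local Open Scope classical_set_scope.
Local Open Scope ring_scope.
Variables (R : realType) (p : R).
Local Notation mu := (@lebesgue_measure R).

Lemma continuous_coin_exp (n : nat) (f : seq bool -> R -> R) :
  (forall l, continuous (f l)) -> continuous (fun t => coin_exp p n (f ^~ t)).
Proof.
elim: n f => [|n IHn] f cf /=; first exact: cf.
move=> t; apply: cvgD; apply: cvgM; try exact: cvg_cst.
  exact: (IHn (fun l => f (true :: l))).
exact: (IHn (fun l => f (false :: l))).
Qed.

Lemma Rintegral_coin_exp (n : nat) (f : seq bool -> R -> R) (a b : R) :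
  (forall l, continuous (f l)) ->
  \int[mu]_(t in `[a, b]) coin_exp p n (f ^~ t) =
  coin_exp p n (fun l => \int[mu]_(t in `[a, b]) f l t).
Proof.
elim: n f => [//|n IHn] f cf /=.
have c1 := @continuous_coin_exp n (fun l => f (true :: l)) (fun l => cf _).
have c2 := @continuous_coin_exp n (fun l => f (false :: l)) (fun l => cf _).
have i1 := @continuous_integrable R _ a b c1.
have i2 := @continuous_integrable R _ a b c2.
rewrite RintegralD//=.
- by rewrite !RintegralZl// !IHn.
- apply: (@continuous_integrable R
    (fun t => p * coin_exp p n (fun l => f (true :: l) t))).
  by move=> t; apply: cvgM; [exact: cvg_cst | exact: c1].
- apply: (@continuous_integrable R
    (fun t => (1 - p) * coin_exp p n (fun l => f (false :: l) t))).
  by move=> t; apply: cvgM; [exact: cvg_cst | exact: c2].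
Qed.

(** The score being an integer, each cosine integrates to 0 unless the score
    is [k]. *)
Lemma pmf_inversion (n : nat) (k : int) (y : R) : (0 < n)%N ->
  y = (n%:Z - k)%:~R ->
  pi * pmf_correct p n k =
  \int[mu]_(t in `[0, pi]) coin_exp p n (fun l => cos (t * ((misses p n l)%:R - y))).
Proof.
move=> n0 yE; rewrite Rintegral_coin_exp; last first.
  move=> l t; apply: (@continuous_comp _ _ _
    (fun t : R => t * ((misses p n l)%:R - y)) cos).
    by apply: cvgM => //; exact: cvg_cst.
  exact: continuous_cos.
have -> : pmf_correct p n k =
    coin_exp p n (fun l => ((score (early_guess p n) 0 0 l)%:Z == k)%:R).
  rewrite -coin_expectation_exp /pmf_correct /coin_prob /coin_expectation.
  rewrite big_mkcond; apply: eq_bigr => e _; rewrite num_correct_score//.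
  by case: ifP; rewrite ?mulr1 ?mulr0.
rewrite -coin_expZ; apply: eq_coin_exp => l sl.
have := score_le_size (early_guess p n) 0 0 l; rewrite sl => sc.
rewrite (_ : (misses p n l)%:R - y =
  (k - (score (early_guess p n) 0 0 l)%:Z)%:~R); last first.
  rewrite yE /misses natrB// !intrB -!pmulrn; ring.
rewrite Rintegral_cos_int subr_eq0 eq_sym.
by case: eqP; rewrite ?mulr1 ?mulr0.
Qed.

(** The Fourier integrals of the law and of the Gaussian factor differ by at
    most the integral of [C t exp(- c n t^2)], which is [O(1 / n)]. *)
Lemma pmf_gauss : 0 < p -> p < 1 -> exists2 C : R, 0 < C &
  exists N : nat, forall (n : nat) (k : int), (N <= n)%N ->
  `|pmf_correct p n k - (Num.sqrt (2 * pi))^-1 *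
    ((Num.sqrt (ascent_variance p * n%:R))^-1 *
     expR (- ((k%:~R - (n%:R - p * (1 - p) * n%:R)) ^+ 2 /
              (2 * (ascent_variance p * n%:R)))))| <= C / n%:R.
Proof.
move=> p0 p1.
have [C [c [C0 c0 [N charN]]]] := cos_misses_gauss p0 p1.
have pq0 : 0 < p * (1 - p) by rewrite mulr_gt0// subr_gt0.
have [v_lb v_ub] := ascent_variance_bounds p0 p1.
set v := ascent_variance p in v_lb v_ub charN *.
have v0 : 0 < v by lra.
exists (C / (2 * c) + 5 / v).
  by rewrite addr_gt0// divr_gt0// mulr_gt0.
exists (maxn N (Num.truncn v^-1).+1) => n k; rewrite geq_max => /andP[Nn vn].
have n0 : (0 < n)%N by exact: leq_trans vn.
have nR : 0 < n%:R :> R by rewrite ltr0n.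
set s := v * n%:R; have s1 : 1 <= s.
  rewrite /s mulrC -ler_pdivrMr// mul1r; apply: ltW.
  apply: lt_le_trans (truncnS_gt v^-1) _.
  by rewrite ler_nat.
have s0 : 0 < s by lra.
set m := p * (1 - p) * n%:R.
pose y : R := (n%:Z - k)%:~R.
have yE : m - y = k%:~R - (n%:R - m).
  by rewrite /y intrB -pmulrn; ring.
have inv := pmf_inversion n0 (erefl y).
rewrite -yE; set a := m - y.
have Gs := gauss_cosine_gauss a s1.
have cn : 0 < c * n%:R by rewrite mulr_gt0.
have cB : continuous (fun t : R => C * (t * expR (- (c * n%:R * t ^+ 2)))).
  have dE (t : R) : is_derive t 1 (fun t : R => expR (- (c * n%:R * t ^+ 2)))
      (- (2 * (c * n%:R) * t) * expR (- (c * n%:R * t ^+ 2))).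
    by apply: is_derive_eq; rewrite /GRing.scale /=; ring.
  move=> t; apply: cvgM; first exact: cvg_cst.
  by apply: cvgM => //; exact: (is_derive_continuous dE).
have diff : `|pi * pmf_correct p n k - gauss_cosine s a| <= C * (2 * (c * n%:R))^-1.
  rewrite inv; apply: (@le_trans _ _
    (\int[mu]_(t in `[0, pi]) (C * (t * expR (- (c * n%:R * t ^+ 2)))))).
    apply: normr_RintegralB_le => //.
    - apply: continuous_coin_exp => l t.
      apply: (@continuous_comp _ _ _ (fun t : R => t * ((misses p n l)%:R - y)) cos).
        by apply: cvgM => //; exact: cvg_cst.
      exact: continuous_cos.
    - move=> t; apply: cvgM.
        have dE (x : R) : is_derive x 1 (fun t : R => expR (- (s * t ^+ 2 / 2)))
            (- (s * x) * expR (- (s * x ^+ 2 / 2))).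
          by apply: is_derive_eq; rewrite /GRing.scale /=; field.
        exact: (is_derive_continuous dE).
      apply: (@continuous_comp _ _ _ (fun t : R => a * t) cos).
        by apply: cvgM => //; exact: cvg_cst.
      exact: continuous_cos.
    move=> t; rewrite in_itv /= => /andP[t0 tpi].
    have t4 : `|t| <= 4 by rewrite ger0_norm//; have := pihalf_lt2 R; lra.
    have := charN n Nn t y t4; rewrite (ger0_norm t0) -/m -/s -/a => /le_trans; apply.
    rewrite (_ : c * t ^+ 2 * n%:R = c * n%:R * t ^+ 2); last by ring.
    by rewrite mulrA.
  rewrite RintegralZl//.
    by rewrite ler_wpM2l ?(ltW C0)//; exact: Rintegral_mul_expR.
  apply: (@continuous_integrable R (fun t => t * expR (- (c * n%:R * t ^+ 2)))).
  move=> t; apply: cvgM => //.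
  have dE (x : R) : is_derive x 1 (fun t : R => expR (- (c * n%:R * t ^+ 2)))
      (- (2 * (c * n%:R) * x) * expR (- (c * n%:R * x ^+ 2))).
    by apply: is_derive_eq; rewrite /GRing.scale /=; ring.
  exact: (is_derive_continuous dE).
have pi0 := pi_gt0 R.
have sqpi : Num.sqrt (2 * pi) * Num.sqrt (2 * pi) = 2 * pi :> R.
  by rewrite -expr2 sqr_sqrtr// mulr_ge0// ltW.
have /andP[q1 q3] := sqrt_2pi_bounds R.
set q := Num.sqrt (2 * pi) in Gs q1 q3 sqpi *.
have sq1 : 1 <= Num.sqrt s by rewrite -sqrtr1 ler_wsqrtr.
set e := expR _ in Gs *.
have qn : q != 0 by rewrite gt_eqF//; lra.
have sn : Num.sqrt s != 0 by rewrite gt_eqF//; lra.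
have -> : pmf_correct p n k - q^-1 * ((Num.sqrt s)^-1 * e) =
    (pi * pmf_correct p n k - q / (2 * Num.sqrt s) * e) / pi.
  have -> : q / (2 * Num.sqrt s) * e = pi * (q^-1 * ((Num.sqrt s)^-1 * e)).
    have -> : pi = q * q / 2 by rewrite sqpi; field.
    by field; rewrite qn sn.
  by rewrite -mulrBr [pi * _]mulrC mulfK// gt_eqF.
rewrite normrM (ger0_norm (_ : 0 <= pi^-1)) ?invr_ge0 ?(ltW pi0)//.
rewrite ler_pdivrMr//.
have tri : `|pi * pmf_correct p n k - q / (2 * Num.sqrt s) * e| <=
    (C / (2 * c) + 5 / v) / n%:R.
  rewrite (_ : _ - _ = (pi * pmf_correct p n k - gauss_cosine s a) +
    (gauss_cosine s a - q / (2 * Num.sqrt s) * e)); last by ring.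
  apply: (le_trans (ler_normD _ _)); apply: (le_trans (lerD diff Gs)).
  rewrite le_eqVlt; apply/orP; left; apply/eqP; rewrite /s.
  by field; rewrite !gt_eqF.
apply: (le_trans tri); rewrite ler_peMr//.
  apply: divr_ge0 => //; apply: addr_ge0; apply: divr_ge0 => //; first exact: ltW; last exact: ltW.
  apply: mulr_ge0 => //; exact: ltW.
by have := pi_ge2 R; lra.
Qed.

End Inversion.

(** * Local limit law *)

Section Final.
Local Open Scope classical_set_scope.
Local Open Scope ring_scope.
Variables (R : realType) (p : R).

Lemma pmf_correct_bounds (n : nat) (k : int) : 0 < p -> p < 1 ->
  0 <= pmf_correct p n k <= 1.
Proof.
move=> p0 p1; rewrite /pmf_correct /coin_prob.
have w0 (e : {ffun 'I_n -> bool}) : 0 <= coin_weight p e.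
  by apply: prodr_ge0 => i _; rewrite /bernoulli_pmf; case: ifP => _; lra.
rewrite sumr_ge0//=.
apply: (@le_trans _ _ (\sum_(e : {ffun 'I_n -> bool}) coin_weight p e)).
  rewrite [leRHS](bigID (fun e => (num_correct p e)%:Z == k)) /= lerDl.
  exact: sumr_ge0.
have := coin_expectation_exp p n (fun=> 1); rewrite coin_exp_cst /coin_expectation.
by move=> <-; apply: ler_sum => e _; rewrite mulr1.
Qed.

Lemma gauss_density_bounds (x : R) :
  0 <= (Num.sqrt (2 * pi))^-1 * expR (- (x ^+ 2 / 2)) <= 1.
Proof.
have /andP[q1 _] := sqrt_2pi_bounds R.
have i0 : 0 <= (Num.sqrt (2 * pi : R))^-1 by rewrite invr_ge0 sqrtr_ge0.
have i1 : (Num.sqrt (2 * pi : R))^-1 <= 1 by rewrite invf_le1//; lra.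
have e1 : expR (- (x ^+ 2 / 2)) <= 1.
  by rewrite -[leRHS]expR0 ler_expR oppr_le0 divr_ge0 ?sqr_ge0.
by rewrite mulr_ge0 ?expR_ge0//= mulr_ile1 ?expR_ge0.
Qed.

(** [P] approximates a density with centre [m] and variance [v n]; the true
    parameters are [mu] and [V].  With [r = sqrt (V / (v n))], the standardised
    abscissa of [k] is [x r + O(n^(-1/2))], the [O] including the rounding of
    [floor], and [r = 1 + O(n^(-1/2))].  The density is Lipschitz for the shift
    and for the scaling. *)
Lemma local_limit_transfer (v K C1 : R) : 0 < v -> 0 < K -> 0 < C1 -> v <= 1 ->
  exists2 C : R, 0 < C & exists N : nat, forall n : nat, (N <= n)%N ->
  forall (V mu m P x : R) (k : int), k = Num.floor (mu + x * Num.sqrt V) ->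
  `|V - v * n%:R| <= K * Num.sqrt n%:R -> `|mu - m| <= K ->
  `|P - (Num.sqrt (2 * pi))^-1 * ((Num.sqrt (v * n%:R))^-1 *
     expR (- ((k%:~R - m) ^+ 2 / (2 * (v * n%:R)))))| <= C1 / n%:R ->
  `|Num.sqrt V * P - (Num.sqrt (2 * pi))^-1 * expR (- (x ^+ 2 / 2))| <=
  C * (Num.sqrt n%:R)^-1.
Proof.
move=> v0 K0 C10 v1.
have w0 : 0 < Num.sqrt v by rewrite sqrtr_gt0.
exists (2 * C1 + 3 * (K / v) + (K + 1) / Num.sqrt v).
  have h1 : 0 < K / v by rewrite divr_gt0.
  have h2 : 0 < (K + 1) / Num.sqrt v by rewrite divr_gt0//; lra.
  lra.
exists (Num.truncn ((2 * K / v) ^+ 2)).+1 => n Nn V mu m P x k kE V_le mu_le P_le.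
(* Large enough for [V >= v n / 2], so that the ratio of scales stays away
   from 0. *)
have n_big : (2 * K / v) ^+ 2 <= n%:R.
  by apply/ltW; apply: lt_le_trans (truncnS_gt _) _; rewrite ler_nat.
have n0 : (0 < n)%N by exact: leq_trans Nn.
have nR : 0 < n%:R :> R by rewrite ltr0n.
set s := v * n%:R in V_le P_le *; have s0 : 0 < s by rewrite mulr_gt0.
set t := Num.sqrt n%:R in V_le *.
have t0 : 0 < t by rewrite sqrtr_gt0.
have tt : t * t = n%:R by rewrite -expr2 sqr_sqrtr// ltW.
have t_big : 2 * K / v <= t.
  have Kv : 0 <= 2 * K / v by rewrite divr_ge0 ?mulr_ge0// ltW.
  by rewrite -(ger0_norm Kv) -sqrtr_sqr ler_wsqrtr.
have sqs : Num.sqrt s = Num.sqrt v * t by rewrite /s sqrtrM// ltW.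
set w := Num.sqrt v in w0 sqs *.
have ws0 : 0 < Num.sqrt s by rewrite sqs mulr_gt0.
have Kt : K * t <= s / 2.
  have : 2 * K <= t * v by rewrite -ler_pdivrMr.
  move=> h; have := ler_wpM2r (ltW t0) h.
  have -> : t * v * t = s by rewrite /s -tt; ring.
  lra.
move: (V_le); rewrite ler_norml => /andP[V1 V2].
have V0 : 0 < V by lra.
pose r := Num.sqrt V / Num.sqrt s.
have r0 : 0 < r by rewrite divr_gt0// sqrtr_gt0.
have r2 : r ^+ 2 = V / s by rewrite expr_div_n !sqr_sqrtr// ltW.
have r2half : 1 / 2 <= r ^+ 2 by rewrite r2 ler_pdivlMr//; lra.
have rdiff : `|r ^+ 2 - 1| <= K / v * t^-1.
  have -> : r ^+ 2 - 1 = (V - s) / s by rewrite r2; field; rewrite gt_eqF.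
  rewrite normrM (gtr0_norm (_ : 0 < s^-1)) ?invr_gt0//.
  rewrite ler_pdivrMr//; apply: (le_trans V_le).
  rewrite le_eqVlt; apply/orP; left; apply/eqP.
  by rewrite /s -tt; field; rewrite !gt_eqF.
have rdiff1 : `|r - 1| <= K / v * t^-1.
  apply: le_trans rdiff; rewrite (_ : r ^+ 2 - 1 = (r - 1) * (r + 1)); last by ring.
  by rewrite normrM ler_peMr// ger0_norm; lra.
have sV : Num.sqrt V = r * Num.sqrt s by rewrite /r divfK// gt_eqF.
set z := (k%:~R - m) / Num.sqrt s.
have zE : (k%:~R - m) ^+ 2 / (2 * s) = z ^+ 2 / 2.
  by rewrite /z expr_div_n sqr_sqrtr ?(ltW s0)//; field; rewrite gt_eqF.
rewrite zE in P_le.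
have z_le : `|z - x * r| <= (K + 1) / w * t^-1.
  have -> : z - x * r = (k%:~R - m - x * Num.sqrt V) / Num.sqrt s.
    by rewrite sV /z; field; rewrite gt_eqF.
  rewrite normrM (gtr0_norm (_ : 0 < (Num.sqrt s)^-1)) ?invr_gt0//.
  rewrite ler_pdivrMr// (_ : _ / w * _ * _ = K + 1); last first.
    by rewrite sqs; field; rewrite !gt_eqF.
  have k1 : k%:~R <= mu + x * Num.sqrt V by rewrite kE floor_le.
  have k2 : mu + x * Num.sqrt V < k%:~R + 1.
    by have := floorD1_gt (mu + x * Num.sqrt V); rewrite -kE intrD.
  move: mu_le; rewrite !ler_norml => /andP[m1 m2]; apply/andP; split; lra.
set c := (Num.sqrt (2 * pi))^-1.
have c0 : 0 <= c by rewrite invr_ge0 sqrtr_ge0.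
have c1 : c <= 1.
  have /andP[q1 _] := sqrt_2pi_bounds R.
  by rewrite /c invf_le1//; lra.
have term1 : `|Num.sqrt V * (P - c * ((Num.sqrt s)^-1 * expR (- (z ^+ 2 / 2))))|
    <= 2 * C1 * t^-1.
  rewrite normrM (ger0_norm (sqrtr_ge0 _)).
  have Vt : Num.sqrt V <= 2 * t.
    rewrite -(ger0_norm (_ : 0 <= 2 * t)); last by rewrite mulr_ge0// ltW.
    rewrite -sqrtr_sqr ler_wsqrtr// exprMn expr2 (expr2 t) tt.
    have : s <= n%:R by rewrite /s ler_piMl// ltW.
    lra.
  apply: (@le_trans _ _ (2 * t * (C1 / n%:R))); first exact: ler_pM.
  by rewrite le_eqVlt; apply/orP; left; apply/eqP; rewrite -tt; field; rewrite gt_eqF.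
have term2 : `|r * expR (- (z ^+ 2 / 2)) - expR (- (x ^+ 2 / 2))| <=
    (3 * (K / v) + (K + 1) / w) * t^-1.
  rewrite (_ : _ - _ = (r - 1) * expR (- (z ^+ 2 / 2)) +
    ((expR (- (z ^+ 2 / 2)) - expR (- ((x * r) ^+ 2 / 2))) +
     (expR (- ((x * r) ^+ 2 / 2)) - expR (- (x ^+ 2 / 2))))); last by ring.
  apply: (le_trans (ler_normD _ _)).
  have h0 : `|(r - 1) * expR (- (z ^+ 2 / 2))| <= K / v * t^-1 * 1.
    rewrite normrM; apply: ler_pM => //.
    rewrite ger0_norm ?expR_ge0// -[leRHS]expR0 ler_expR oppr_le0.
    by rewrite divr_ge0 ?sqr_ge0.
  have h1 := le_trans (gauss_lipschitz z (x * r)) z_le.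
  have h2 := gauss_scale x r2half.
  have h3 := ler_normD (expR (- (z ^+ 2 / 2)) - expR (- ((x * r) ^+ 2 / 2)))
    (expR (- ((x * r) ^+ 2 / 2)) - expR (- (x ^+ 2 / 2))).
  lra.
rewrite (_ : _ - _ =
  Num.sqrt V * (P - c * ((Num.sqrt s)^-1 * expR (- (z ^+ 2 / 2)))) +
  c * (r * expR (- (z ^+ 2 / 2)) - expR (- (x ^+ 2 / 2)))); last first.
  by rewrite /r; ring.
apply: (le_trans (ler_normD _ _)).
have term2' : `|c * (r * expR (- (z ^+ 2 / 2)) - expR (- (x ^+ 2 / 2)))| <=
    1 * ((3 * (K / v) + (K + 1) / w) * t^-1).
  by rewrite normrM (ger0_norm c0); apply: ler_pM.
apply: (le_trans (lerD term1 term2')).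
by rewrite le_eqVlt; apply/orP; left; apply/eqP; ring.
Qed.

End Final.

Theorem theorem5 (R : realType) (p : R) (p_gt0 : 0 < p) (p_lt1 : p < 1) :
  exists (C : R) (eps : nat -> R),
    [/\ 0 < C,
        (exists N : nat, forall n : nat, (N <= n)%N ->
           eps n <= C * (n%:R `^ (- 2^-1)))
      & gaussian_local_limit_law
          (mean_correct p) (stddev_correct p) (pmf_correct p) eps].
Proof.
have [K K0 [N1 moments]] := moments_correct p_gt0 p_lt1.
have [C1 C10 [N2 local]] := pmf_gauss p_gt0 p_lt1.
have [v_lb v_ub] := ascent_variance_bounds p_gt0 p_lt1.
have pq0 : 0 < p * (1 - p) by rewrite mulr_gt0// subr_gt0.
have v0 : 0 < ascent_variance p by lra.
have v1 : ascent_variance p <= 1 by lra.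
have [C C0 [N3 transfer]] := local_limit_transfer v0 K0 C10 v1.
pose N := maxn N1 (maxn N2 N3).
(* For the finitely many other [n], a bound by the sum of the two terms. *)
exists C, (fun n => if (N <= n)%N then C * (n%:R `^ (- 2^-1))
                    else stddev_correct p n + 1); split => //.
  by exists N => n ->.
move=> n n0; apply: ub_ereal_sup => _ [x _ <-]; rewrite lee_fin.
case: ifPn => [|_].
  rewrite !geq_max => /and3P[n1 n2 n3].
  rewrite powRN powR12_sqrt ?ler0n//.
  have [mean_le var_le] := moments n n1.
  exact: (transfer n n3 _ _ _ _ x _ erefl var_le mean_le (local n _ n2)).
have /andP[P0 P1] := pmf_correct_bounds n
  (Num.floor (mean_correct p n + x * stddev_correct p n)) p_gt0 p_lt1.
have /andP[g0 g1] := gauss_density_bounds x.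
apply: (le_trans (ler_normB _ _)); apply: lerD; last by rewrite ger0_norm.
rewrite ger0_norm; first by rewrite ler_piMr// sqrtr_ge0.
by rewrite mulr_ge0// sqrtr_ge0.
Qed.
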